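(* Let $H\in(0,1)$ and $K\in(0,1)$. Let $B^{H,K}=(B^{H,K}_t,\ t\ge 0)$ be a bifractional Brownian motion with parameters $H,K$, and suppose that $(W_\theta,\ \theta\ge 0)$ is a standard Brownian motion independent of $B^{H,K}$. Define $$X^K_t=\int_0^\infty (1-e^{-\theta t})\,\theta^{-\frac{1+K}{2}}\,dW_\theta,\quad t\ge 0,\qquad X^{H,K}_t = X^K_{t^{2H}},\quad t\ge 0.$$ Let $B^{HK}=(B^{HK}_t,\ t\ge 0)$ be a fractional Brownian motion with Hurst parameter $HK$. Then the processes $$\left(C_1 X^{H,K}_t + B^{H,K}_t,\ t\ge 0\right)\quad\text{and}\quad \left(C_2 B^{HK}_t,\ t\ge 0\right)$$ have the same distribution, where $C_1=\sqrt{\dfrac{2^{-K}K}{\Gamma(1-K)}}$ and $C_2=2^{\frac{1-K}{2}}$.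
   Context: A bifractional Brownian motion with parameters $H\in(0,1)$, $K\in(0,1]$ is a centered Gaussian process $B^{H,K}=(B^{H,K}_t,\ t\ge 0)$ with covariance $$R^{H,K}(t,s)=2^{-K}\left((t^{2H}+s^{2H})^K-|t-s|^{2HK}\right).$$ A fractional Brownian motion with Hurst parameter $h\in(0,1)$ is a centered Gaussian process $B^h=(B^h_t,\ t\ge0)$ with covariance $\frac12\left(t^{2h}+s^{2h}-|t-s|^{2h}\right)$; here $h$ is the product $HK$. The integral defining $X^K_t$ is a Wiener integral of a deterministic square-integrable function with respect to the Brownian motion $W$. $\Gamma$ is the Gamma function. *)

(* Defs.v *)
From HB Require Import structures.
From mathcomp Require Import all_boot all_order all_algebra.
From mathcomp Require Import all_classical all_reals all_analysis.
Import Order.TTheory GRing.Theory Num.Theory.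
Import numFieldNormedType.Exports.
Set Implicit Arguments.
Unset Strict Implicit.
Unset Printing Implicit Defensive.
Local Open Scope classical_set_scope.
Local Open Scope ring_scope.

Definition Gamma {R : realType} (z : R) : R :=
  \int[lebesgue_measure]_(x in `]0, +oo[) (x `^ (z - 1) * expR (- x)).

(* Processes are families indexed by R; only the times t >= 0 are constrained
   by the predicates below, the values at negative times being irrelevant. *)
Section processes.
Context {d : measure_display} {T : measurableType d} {R : realType}.
Implicit Types (P : probability T R) (Y : T -> R).

(* Laws are only compared on measurable sets. The Dirac mass accounts for
   degenerate variables: normal_prob m 0 is not the Dirac mass at m. *)
Definition is_normal P Y (m s : R) : Prop :=
  forall A : set R, measurable A ->
    P (Y @^-1` A) = if s == 0 then \d_m A else normal_prob m s A.

Definition is_gaussian P Y : Prop := exists m s : R, is_normal P Y m s.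

Definition gaussian_process P (X : R -> {RV P >-> R}) : Prop :=
  forall (n : nat) (t a : 'I_n -> R), (forall i, 0 <= t i) ->
    is_gaussian P (fun w => \sum_(i < n) a i * X (t i) w).

Definition centered_gaussian_process P (X : R -> {RV P >-> R})
    (C : R -> R -> R) : Prop :=
  [/\ gaussian_process X,
      forall t : R, 0 <= t -> ('E_P[X t] = 0)%E
    & forall t s : R, 0 <= t -> 0 <= s -> covariance P (X t) (X s) = (C t s)%:E].

Definition bifractional_cov (H K t s : R) : R :=
  2 `^ (- K) * ((t `^ (2 * H) + s `^ (2 * H)) `^ K - `|t - s| `^ (2 * H * K)).

Definition bifractional_brownian_motion P (H K : R)
    (B : R -> {RV P >-> R}) : Prop :=
  centered_gaussian_process B (bifractional_cov H K).

Definition fractional_cov (h t s : R) : R :=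
  2^-1 * (t `^ (2 * h) + s `^ (2 * h) - `|t - s| `^ (2 * h)).

Definition fractional_brownian_motion P (h : R)
    (B : R -> {RV P >-> R}) : Prop :=
  centered_gaussian_process B (fractional_cov h).

(* Mutual independence: the product rule for subfamilies is recovered by
   taking A i = setT. *)
Definition independent_family P n (Y : 'I_n -> T -> R) : Prop :=
  forall A : 'I_n -> set R, (forall i, measurable (A i)) ->
    P (\bigcap_(i in [set: 'I_n]) (Y i @^-1` A i)) =
    (\prod_(i < n) P (Y i @^-1` A i))%E.

Definition brownian_motion P (W : R -> {RV P >-> R}) : Prop :=
  [/\ {ae P, forall w, W 0 w = 0},
      forall (n : nat) (t : nat -> R),
        0 <= t 0%N -> {homo t : i j / (i <= j)%N >-> i <= j} ->
        independent_family P (fun (i : 'I_n) w => W (t i.+1) w - W (t i) w),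
      forall s t : R, 0 <= s <= t ->
        is_normal P (fun w => W t w - W s w) 0 (Num.sqrt (t - s))
    & {ae P, forall w, {within `[0, +oo[, continuous (fun t => W t w)}}].

Definition process_sigma_algebra P (X : R -> {RV P >-> R}) : set (set T) :=
  <<s [set E | exists t : R, exists A : set R,
         [/\ 0 <= t, measurable A & E = X t @^-1` A]] >>.

Definition independent_processes P (X Y : R -> {RV P >-> R}) : Prop :=
  forall E F : set T, process_sigma_algebra X E -> process_sigma_algebra Y F ->
    P (E `&` F) = (P E * P F)%E.

Definition step_function (n : nat) (t a : nat -> R) (x : R) : R :=
  \sum_(i < n) a i * \1_(`]t i, t i.+1]%classic) x.

Definition step_wiener_integral P (W : R -> {RV P >-> R})
    (n : nat) (t a : nat -> R) (w : T) : R :=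
  \sum_(i < n) a i * (W (t i.+1) w - W (t i) w).

(* Y is (a version of) the Wiener integral over [0, +oo[ of the square
   integrable function f: the L^2(P)-limit of the integrals of step functions
   approximating f in L^2([0, +oo[). *)
Definition is_wiener_integral P (W : R -> {RV P >-> R})
    (f : R -> R) (Y : {RV P >-> R}) : Prop :=
  [/\ measurable_fun (`[0, +oo[%classic : set R) f,
      lebesgue_measure.-integrable (`[0, +oo[%classic : set R)
        (fun x => (f x ^+ 2)%:E)
    & exists n : nat -> nat, exists t a : nat -> nat -> R,
      [/\ forall k, 0 <= t k 0%N /\ {homo t k : i j / (i <= j)%N >-> i <= j},
          (\int[lebesgue_measure]_(x in (`[0%R, +oo[%classic : set R))
             ((step_function (n k) (t k) (a k) x - f x) ^+ 2)%:E)%E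
            @[k --> \oo] --> 0%E
        & ('E_P[fun w =>
             ((step_wiener_integral W (n k) (t k) (a k) w - Y w) ^+ 2)%R])%E
            @[k --> \oo] --> 0%E]].

End processes.

(* Cylinder sets generating the product sigma-algebra of R^[0, +oo[. *)
Definition cylinders {R : realType} : set (set ({nonneg R} -> R)) :=
  [set E | exists t : {nonneg R}, exists A : set R,
     measurable A /\ E = [set x | A (x t)]].

Definition sample_path {T : Type} {R : realType} (X : R -> T -> R) (w : T) :
  {nonneg R} -> R := fun t => X t%:num w.

Definition same_distribution {R : realType} {d d' : measure_display}
    {T : measurableType d} {T' : measurableType d'}
    (P : probability T R) (X : R -> T -> R)
    (P' : probability T' R) (Y : R -> T' -> R) : Prop :=
  forall E, <<s @cylinders R >> E ->
    P (sample_path X @^-1` E) = P' (sample_path Y @^-1` E).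

(* Main.v *)
Require Import Defs.
From HB Require Import structures.
From mathcomp Require Import all_boot all_order all_algebra.
From mathcomp Require Import all_classical all_reals all_analysis.
From mathcomp Require Import measurable_realfun ring lra.
Import Order.TTheory GRing.Theory Num.Theory.
Import numFieldNormedType.Exports.
Set Implicit Arguments.
Unset Strict Implicit.
Unset Printing Implicit Defensive.
Local Open Scope classical_set_scope.
Local Open Scope ring_scope.

(** Both processes are centered Gaussian, so everything reduces to an identity
    of covariances. Expanding (1 - a)(1 - b) = (1 - a) + (1 - b) - (1 - ab) for
    a = exp(-x t), b = exp(-x u), and using
      \int_0^oo (1 - exp(-x t)) x^(-1-K) dx = Gamma(1-K) t^K / K
    (Tonelli on 1 - exp(-x t) = \int_0^t x exp(-x y) dy), the Wiener integral
    X^K has covariance Gamma(1-K)/K (t^K + u^K - (t+u)^K). At the times t^(2H),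
    the term (t^(2H) + u^(2H))^K cancels the one in the bifractional covariance.

    Laws are handled through the numbers E cos(sum a_i Z_i + e), the phase e
    playing the role of the imaginary part of the characteristic function. For a
    normal variable they come from Stein's identity and a linear differential
    equation; independence turns them into products by the addition formula of
    cos; they pass to L^2 limits. They determine the joint law of (Z_i): the
    functions x |-> cos(sum a_i x_i + e) span an algebra of trigonometric
    polynomials, and indicators of boxes prod ]-oo, a_i[ are bounded pointwise
    limits of these. *)

(** * Integrals of real functions *)

(** Knowing the integral of [cos (Z + e)] for every phase [e] amounts to knowing the real and
    imaginary parts of a characteristic function, with only bounded real integrands. The recurring
    shape [cos e * v] says in addition that this characteristic function is the real number [v];
    independent sums and L^2 limits preserve that shape. The obstacle is that [X] is known only
    through L^2 limits of step integrals: it is given neither as a Gaussian process nor as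
    independent of [B], and such a limit is measurable for the sigma-algebra of [W] only up to null
    sets. Independence is therefore applied to the step integrals, and the limit is taken
    afterwards, inside the cosine integral of the whole sum; on the other side the exponents
    converge because squared L^2 norms do. Boxes play the role of an inversion theorem. For large
    [N], [sin ((x - a) / (N + 1))] has the sign of [x - a], and the polynomials
    [(1 - p ^+ k) ^+ (k * 2 ^ k)] turn a sign into an indicator, in the spirit of the elementary
    proofs of the Stone-Weierstrass theorem. *)

Lemma integrable_bounded d (T : measurableType d) (R : realType)
    (P : probability T R) (M : R) (f : T -> R) :
  measurable_fun setT f -> (forall x, `|f x| <= M) ->
  P.-integrable setT (EFin \o f).
Proof.
move=> mf fM; apply: measurable_bounded_integrable => //.
  by rewrite (le_lt_trans (probability_le1 P measurableT))// ltry.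
exists M; split; first exact: num_real.
by move=> x Mx y _; exact: le_trans (fM y) (ltW Mx).
Qed.

Lemma dominated_cvg_Rintegral d (T : measurableType d) (R : realType)
    (mu : {measure set T -> \bar R}) (D : set T) (f_ : nat -> T -> R)
    (f g : T -> R) :
  measurable D ->
  (forall n, measurable_fun D (f_ n)) -> measurable_fun D f ->
  (forall x, D x -> f_ n x @[n --> \oo] --> f x) ->
  mu.-integrable D (EFin \o g) ->
  (forall n x, D x -> `|f_ n x| <= g x) ->
  mu.-integrable D (EFin \o f) /\
  \int[mu]_(x in D) f_ n x @[n --> \oo] --> \int[mu]_(x in D) f x.
Proof.
move=> mD mf_ mf f_f ig f_g.
have [] := @dominated_convergence _ _ _ mu D mD (fun n x => (f_ n x)%:E)
  (fun x => (f x)%:E) (EFin \o g).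
- by move=> n; apply/measurable_EFinP.
- exact/measurable_EFinP.
- by apply: aeW => x Dx; apply: cvg_EFin; [exact: nearW|exact: f_f].
- exact: ig.
- by apply: aeW => x n Dx; rewrite lee_fin f_g.
move=> fint _ cv; split => //.
rewrite /Rintegral; apply: fine_cvg; rewrite fineK//.
exact: integrable_fin_num.
Qed.

Lemma bounded_cvg_Rintegral d (T : measurableType d) (R : realType)
    (P : probability T R) (M : R) (f_ : nat -> T -> R) (f : T -> R) :
  (forall n, measurable_fun setT (f_ n)) -> measurable_fun setT f ->
  (forall x, f_ n x @[n --> \oo] --> f x) ->
  (forall n x, `|f_ n x| <= M) ->
  \int[P]_x f_ n x @[n --> \oo] --> \int[P]_x f x.
Proof.
move=> mf_ mf f_f f_M.
have [//|//|//|//| | |//] := @dominated_cvg_Rintegral _ T R P setT f_ f (cst M).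
- by apply: (@integrable_bounded _ _ _ _ `|M|) => //; exact: measurable_cst.
- by move=> n x _; exact: f_M.
Qed.

Lemma squeeze_cvg_norm (R : realType) (u v : nat -> R) (l : R) :
  (forall n, `|u n - l| <= v n) -> v n @[n --> \oo] --> (0 : R) ->
  u n @[n --> \oo] --> l.
Proof.
move=> uv v0; apply/cvgrPdist_le => e e0.
move/cvgrPdist_le : v0 => /(_ _ e0); apply: filterS => n.
rewrite sub0r normrN distrC => ve.
exact: le_trans (uv n) (le_trans (ler_norm _) ve).
Qed.

Lemma ler_norm_1Dsqr (R : realType) (y : R) : `|y| <= 1 + y ^+ 2.
Proof.
rewrite -(real_normK (num_real y)).
by have := sqr_ge0 (`|y| - 1); have := normr_ge0 y; nra.
Qed.

Lemma Rintegral_sum d (T : measurableType d) (R : realType)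
    (mu : {measure set T -> \bar R}) (D : set T) (I : Type) (r : seq I)
    (f : I -> T -> R) :
  measurable D -> (forall i, mu.-integrable D (EFin \o f i)) ->
  mu.-integrable D (EFin \o (fun x => \sum_(i <- r) f i x)) /\
  \int[mu]_(x in D) (\sum_(i <- r) f i x) = \sum_(i <- r) \int[mu]_(x in D) f i x.
Proof.
move=> mD fi; elim: r => [|i r [ir er]].
  have e0 : (fun x => \sum_(i <- [::]) f i x) = cst 0.
    by apply/funext => x; rewrite big_nil.
  rewrite e0 big_nil; split; first exact: integrable0.
  by rewrite Rintegral_cst// mul0r.
have eS : (fun x => \sum_(j <- i :: r) f j x) =
    (fun x => f i x + \sum_(j <- r) f j x).
  by apply/funext => x; rewrite big_cons.
split; last by rewrite eS RintegralD// er big_cons.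
by rewrite eS /comp; under eq_fun do rewrite EFinD; apply: integrableD => //; exact: fi.
Qed.

Lemma normrM_le1 (R : realType) (x y : R) :
  `|x| <= 1 -> `|y| <= 1 -> `|x * y| <= 1.
Proof. by move=> x1 y1; rewrite normrM mulr_ile1. Qed.

Lemma normr_cos_le1 (R : realType) (x : R) : `|cos x| <= 1.
Proof. by rewrite ler_norml cos_geN1 cos_le1. Qed.

Lemma normr_sin_le1 (R : realType) (x : R) : `|sin x| <= 1.
Proof. by rewrite ler_norml sin_geN1 sin_le1. Qed.

Lemma Rintegral_sqr_sum d (T : measurableType d) (R : realType)
    (mu : {measure set T -> \bar R}) (D : set T) (n : nat) (c : 'I_n -> R)
    (f : 'I_n -> T -> R) : measurable D ->
  (forall i j, mu.-integrable D (EFin \o (fun x => f i x * f j x))) ->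
  \int[mu]_(x in D) (\sum_(i < n) c i * f i x) ^+ 2 =
  \sum_(i < n) \sum_(j < n) c i * c j * \int[mu]_(x in D) (f i x * f j x).
Proof.
move=> mD iff.
(* Flattening the double sum to one sum over pairs makes a single use of linearity enough. *)
pose pairs := [seq (i, j) | i <- index_enum 'I_n, j <- index_enum 'I_n].
transitivity (\int[mu]_(x in D) (\sum_(p <- pairs)
    (c p.1 * c p.2) * (f p.1 x * f p.2 x))).
  apply: eq_Rintegral => w _; rewrite expr2 big_distrl/=.
  rewrite big_allpairs; apply: eq_bigr => i _.
  by rewrite big_distrr/=; apply: eq_bigr => j _; rewrite mulrACA.
have [p|_ ->] := @Rintegral_sum _ _ _ mu D _ pairs
  (fun p x => (c p.1 * c p.2) * (f p.1 x * f p.2 x)) mD.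
  by rewrite /comp; under eq_fun do rewrite EFinM; apply: integrableZl => //; exact: iff.
rewrite big_allpairs; apply: eq_bigr => i _; apply: eq_bigr => j _ /=.
by rewrite RintegralZl//; exact: iff.
Qed.

(** * Normal variables *)

Section normal_moments.
Context {R : realType}.
Variables (m s : R).
Hypothesis s0 : s != 0.
Let mu := @lebesgue_measure R.
Let p := normal_pdf m s.

Lemma is_derive_normal_pdf (x : R) :
  is_derive x 1 p (- (x - m) / s ^+ 2 * p x).
Proof.
rewrite /p normal_pdfE//.
apply: is_derive_eq.
rewrite /GRing.scale/= /normal_fun.
have s2 : s ^+ 2 != 0 by rewrite sqrf_eq0.
set E := expR _.
by field.
Qed.

(** Doubling the standard deviation absorbs a quadratic factor. The wider density then serves twice:
    as an integrable majorant for everything of quadratic growth, and to make boundary terms vanish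
    in an integration by parts. *)
Lemma normal_pdf_sqr_le :
  exists C : R, 0 <= C /\
    forall x, (1 + (x - m) ^+ 2) * p x <= C * normal_pdf m (2 * s) x.
Proof.
rewrite /p !normal_pdfE//; last by rewrite mulf_neq0.
have ps : 0 < normal_peak s by exact: normal_peak_gt0.
have ps2 : 0 < normal_peak (2 * s) by apply: normal_peak_gt0; rewrite mulf_neq0.
have s2 : 0 < s ^+ 2 by rewrite exprn_even_gt0.
exists ((1 + 8 * s ^+ 2) * normal_peak s / normal_peak (2 * s)).
split; first by apply/ltW/divr_gt0 => //; apply: mulr_gt0 => //; nra.
move=> x; rewrite [leRHS]mulrA divfK ?gt_eqF//.
rewrite mulrCA [leRHS]mulrAC [leRHS]mulrC ler_pM2l// /normal_fun.
(* In this unit the two exponents are [- 4 u] and [- u], so what remains is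
   [1 + 8 s^2 u <= (1 + 8 s^2) exp(3 u)], which follows from [1 + 3 u <= exp(3 u)]. *)
set y := x - m; set u := y ^+ 2 / (8 * s ^+ 2).
have u0 : 0 <= u by rewrite divr_ge0 ?sqr_ge0// mulr_ge0// ltW.
have -> : - y ^+ 2 / (s ^+ 2 *+ 2) = - (3 * u) + - u.
  by rewrite /u; field.
have -> : - y ^+ 2 / ((2 * s) ^+ 2 *+ 2) = - u.
  by rewrite /u; field.
rewrite expRD mulrA ler_pM2r ?expR_gt0//.
have -> : y ^+ 2 = 8 * s ^+ 2 * u by rewrite /u; field.
rewrite expRN ler_pdivrMr ?expR_gt0//.
have := expR_ge1Dx (3 * u) => h.
apply: (@le_trans _ _ ((1 + 8 * s ^+ 2) * (1 + 3 * u))).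
  have aux (a b : R) : 0 <= a -> 0 <= b -> 1 + 8 * a * b <= (1 + 8 * a) * (1 + 3 * b).
    by move=> a0 b0; have := mulr_ge0 a0 b0; nra.
  by apply: aux => //; exact: ltW.
by rewrite ler_wpM2l// addr_ge0// mulr_ge0// ltW.
Qed.

Lemma integrable_normal_quadratic (g : R -> R) (C : R) :
  measurable_fun setT g -> (forall x, `|g x| <= C * (1 + (x - m) ^+ 2)) ->
  mu.-integrable setT (fun x => (g x * p x)%:E).
Proof.
move=> mg gC; have [D [D0 hD]] := normal_pdf_sqr_le.
have C0 : 0 <= C.
  have := le_trans (normr_ge0 _) (gC m).
  by rewrite subrr expr0n addr0 mulr1.
apply: (@le_integrable _ _ R mu setT _ _
  (fun x => (C * D)%:E * (normal_pdf m (2 * s) x)%:E)%E) => //.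
- apply/measurable_EFinP; apply: measurable_funM => //.
  exact: measurable_normal_pdf.
- move=> x _ /=; rewrite lee_fin normrM (ger0_norm (normal_pdf_ge0 _ _ _)).
  rewrite (le_trans _ (ler_norm _))//.
  rewrite (le_trans (ler_wpM2r (normal_pdf_ge0 _ _ _) (gC x)))//.
  by rewrite -!mulrA ler_wpM2l.
- by apply: integrableZl => //; exact: integrable_normal_pdf.
Qed.

Let intv (N : nat) : set R := `[m - N.+1%:R, m + N.+1%:R]%classic.

(** Since [s^2 p' = - (x - m) p], the difference of the two integrands is the derivative of
    [s^2 g p]. Its integral over [intv N] is a boundary term of order [1 / N], and dominated
    convergence extends the integral to the whole line. *)
Lemma normal_pdf_stein (g g' : R -> R) (C : R) :
  (forall x : R, is_derive x (1 : R) g (g' x)) -> continuous g' ->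
  (forall x, `|g x| <= C * (1 + `|x - m|)) ->
  (forall x, `|g' x| <= C) ->
  \int[mu]_x ((x - m) * g x * p x) = s ^+ 2 * \int[mu]_x (g' x * p x).
Proof.
move=> dg cg' gC g'C.
have C0 : 0 <= C by exact: le_trans (g'C 0).
have cg : continuous g.
  by move=> x; apply: differentiable_continuous; apply/derivable1_diffP.
have mg : measurable_fun setT g by exact: continuous_measurable_fun.
have mg' : measurable_fun setT g' by exact: continuous_measurable_fun.
have cp : continuous p by exact: continuous_normal_pdf.
have cxm : continuous (fun x : R => x - m).
  by move=> x; apply: cvgB => //; exact: cvg_cst.
have s2 : s ^+ 2 != 0 by rewrite sqrf_eq0.
have int1 : mu.-integrable setT (fun x => (g' x * p x)%:E).
  apply: (integrable_normal_quadratic mg' (C := C)) => x.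
  by rewrite (le_trans (g'C x))// ler_peMr// lerDl sqr_ge0.
have int2 : mu.-integrable setT (fun x => ((x - m) * g x * p x)%:E).
  apply: (@integrable_normal_quadratic _ (C * 2)).
    by apply: measurable_funM => //; exact: continuous_measurable_fun.
  move=> x; rewrite normrM.
  rewrite (le_trans (ler_wpM2l (normr_ge0 _) (gC x)))//.
  rewrite -(real_normK (num_real (x - m))).
  move: (normr_ge0 (x - m)); set y := `|x - m| => y0.
  rewrite mulrCA -mulrA ler_wpM2l//.
  by have := sqr_ge0 (y - 1); nra.
pose F x := s ^+ 2 * (g x * p x).
pose f x := s ^+ 2 * (g' x * p x) - (x - m) * g x * p x.
have dF (x : R) : is_derive x (1 : R) F (f x).
  have ? := is_derive_normal_pdf x.
  rewrite /F; apply: is_derive_eq.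
  rewrite /f /GRing.scale/= /GRing.scale/=; field.
  exact: s0.
have cf : continuous f.
  move=> x; rewrite /f; apply: cvgB.
    by apply: cvgM; [exact: cvg_cst|apply: cvgM; [exact: cg'|exact: cp]].
  apply: cvgM; last exact: cp.
  by apply: cvgM; [exact: cxm|exact: cg].
have cF : continuous F.
  by move=> x; apply: differentiable_continuous; apply/derivable1_diffP.
have intf : mu.-integrable setT (fun x => (f x)%:E).
  rewrite /f; under eq_fun do rewrite EFinB EFinM.
  by apply: integrableB => //; apply: integrableZl.
have ftc N : \int[mu]_(x in intv N) f x = F (m + N.+1%:R) - F (m - N.+1%:R).
  rewrite /Rintegral (@continuous_FTC2 _ _ F)//.
  - by rewrite ltrD2l; exact: gtrN.
  - by apply: continuous_subspaceT => x; exact: cf.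
  - split => [x _||]; first exact: ex_derive.
    + by apply: cvg_at_right_filter; exact: cF.
    + by apply: cvg_at_left_filter; exact: cF.
  - by move=> x _; rewrite derive1E derive_val.
(* Read with [y = |x - m|], [a = |g x|], [b = p x], [q] the wider density and [M] its peak. The
   growth of [g] uses one factor [1 + y]; the second one, which gives the decay, is affordable
   because [(1 + y)^2 <= 2 (1 + y^2)]. *)
have aux (y a b q M D : R) : 0 <= y -> 0 <= b -> 0 <= D -> q <= M ->
    (1 + y ^+ 2) * b <= D * q -> a <= C * (1 + y) ->
    a * b * (1 + y) <= C * 2 * D * M.
  move=> y0 b0 D0 qM h1 h2.
  apply: (@le_trans _ _ (C * (1 + y) * (b * (1 + y)))).
    by rewrite -mulrA ler_wpM2r// mulr_ge0// addr_ge0.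
  rewrite -!mulrA ler_wpM2l//.
  apply: (@le_trans _ _ (2 * ((1 + y ^+ 2) * b))).
    rewrite [leLHS](_ : _ = (1 + y) ^+ 2 * b); last by ring.
    rewrite mulrA ler_wpM2r//.
    by have := sqr_ge0 (y - 1); nra.
  rewrite ler_wpM2l// (le_trans h1)//.
  by rewrite ler_wpM2l.
have [D [D0 hD]] := normal_pdf_sqr_le.
have pk2 : 0 <= normal_peak (2 * s) by exact: normal_peak_ge0.
have s20 : 2 * s != 0 by rewrite mulf_neq0.
have Fle x : `|F x| <= s ^+ 2 * C * 2 * D * normal_peak (2 * s) / (1 + `|x - m|).
  rewrite ler_pdivlMr ?ltr_pwDl// /F normrM (ger0_norm (sqr_ge0 s)) normrM.
  rewrite (ger0_norm (normal_pdf_ge0 _ _ _)).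
  rewrite [leRHS](_ : _ = s ^+ 2 * (C * 2 * D * normal_peak (2 * s))); last by ring.
  rewrite -[leLHS]mulrA; apply: ler_wpM2l; first exact: sqr_ge0.
  apply: (aux _ _ _ (normal_pdf m (2 * s) x)) => //.
  - exact: normal_pdf_ge0.
  - exact: normal_pdf_ub.
  - by rewrite (real_normK (num_real (x - m))).
have bnd : (F (m + N.+1%:R) - F (m - N.+1%:R)) @[N --> \oo] --> (0 : R).
  pose K := s ^+ 2 * C * 2 * D * normal_peak (2 * s).
  have K0 : 0 <= K by rewrite /K; do 4 (apply: mulr_ge0 => //); exact: sqr_ge0.
  apply: (@squeeze_cvg_norm _ _ (fun N => K *+ 2 * harmonic N)) => [N|].
    rewrite subr0 (le_trans (ler_normB _ _))//.
    rewrite mulrnAl mulr2n lerD// (le_trans (Fle _))//.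
      rewrite addrAC subrr add0r normr_nat ler_wpM2l// lef_pV2 ?posrE//.
      by rewrite lerDr.
    rewrite addrAC subrr add0r normrN normr_nat ler_wpM2l// lef_pV2 ?posrE//.
    by rewrite lerDr.
  rewrite -(mulr0 (K *+ 2)); apply: cvgM; first exact: cvg_cst.
  exact: cvg_harmonic.
have lim : \int[mu]_x (f \_ (intv N)) x @[N --> \oo] --> \int[mu]_x f x.
  have [//| | | | | |_ //] := @dominated_cvg_Rintegral _ _ _ mu setT
    (fun N => f \_ (intv N)) f (fun x => `|f x|).
  - move=> N; apply/(measurable_restrictT f); first exact: measurable_itv.
    by apply: measurable_funTS; exact: continuous_measurable_fun.
  - exact: continuous_measurable_fun.
  - move=> x _; apply: (@cvg_near_cst _ _ _ _ _).
    exists (Num.truncn `|x - m|) => // N /= hN.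
    rewrite patchE ifT// inE /intv/= in_itv/= -ler_distl.
    have := truncnS_gt `|x - m|.
    move/ltW/le_trans; apply.
    by rewrite ler_nat.
  - exact: (integrable_norm intf).
  - move=> N x _; rewrite patchE; case: ifPn => // _.
    by rewrite normr0.
have eq0 : \int[mu]_x f x = 0.
  move: lim; rewrite (_ : (fun N => _) =
    (fun N : nat => F (m + N.+1%:R) - F (m - N.+1%:R))) => [lim|]; last first.
    by apply/funext => N; rewrite -Rintegral_mkcond ftc.
  exact: cvg_unique lim bnd.
have : \int[mu]_x (s ^+ 2 * (g' x * p x)) - \int[mu]_x ((x - m) * g x * p x) = 0.
  rewrite -[RHS]eq0 -RintegralB//.
  by rewrite /comp; under eq_fun do rewrite EFinM; apply: integrableZl.
rewrite RintegralZl// => /eqP; rewrite subr_eq0 => /eqP ->//.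
Qed.

End normal_moments.

Section normal_char.
Context {R : realType}.
Variables (m s : R).
Hypothesis s0 : s != 0.
Let mu := @lebesgue_measure R.
Let p := normal_pdf m s.

Let Rintegral_pdf : \int[mu]_x p x = 1.
Proof. by rewrite /Rintegral integral_normal_pdf. Qed.

Let is_derive_cos (d x : R) (t : R) :
  is_derive t (1 : R) (fun t => cos (t * (x - m) + d) * p x)
    (- (x - m) * sin (t * (x - m) + d) * p x).
Proof.
apply: is_derive_eq; rewrite /GRing.scale/= /GRing.scale/=; ring.
Qed.

Let phi (d t : R) := \int[mu]_x (cos (t * (x - m) + d) * p x).

Let measurable_lin (t d : R) :
  measurable_fun [set: measurableTypeR R] (fun x : R => t * (x - m) + d).
Proof.
by apply: measurable_funD => //; apply: measurable_funM => //; exact: measurable_funB.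
Qed.

Let measurable_cosl (t d : R) :
  measurable_fun [set: measurableTypeR R] (fun x : R => cos (t * (x - m) + d)).
Proof.
apply: measurableT_comp (measurable_lin t d).
exact: continuous_measurable_fun (@continuous_cos R).
Qed.

Let measurable_sinl (t d : R) :
  measurable_fun [set: measurableTypeR R] (fun x : R => sin (t * (x - m) + d)).
Proof.
apply: measurableT_comp (measurable_lin t d).
exact: continuous_measurable_fun (@continuous_sin R).
Qed.

Let int_cos (t d : R) :
  mu.-integrable setT (fun x => (cos (t * (x - m) + d) * p x)%:E).
Proof.
apply: (integrable_normal_quadratic s0 (measurable_cosl t d) (C := 1)) => x.
rewrite mul1r (@le_trans _ _ 1) ?ler_norml ?cos_geN1 ?cos_le1//.
by rewrite lerDl sqr_ge0.
Qed.

Let phi_derive (d t : R) : is_derive t (1 : R) (phi d) (- (s ^+ 2 * t) * phi d t).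
Proof.
pose f (t : R) (x : R) := cos (t * (x - m) + d) * p x.
pose G (x : R) := `|x - m| * p x.
have Gge0 y : 0 <= G y by rewrite mulr_ge0// normal_pdf_ge0.
(* Differentiation under the integral is local in the parameter. The majorant [G] of the partial
   derivative does not depend on [t], so any open interval around [t] will do. *)
have It : `]t - 1, t + 1[%classic t.
  by rewrite /= in_itv/= ltrDl ltrBlDr ltrDl ltr01.
have intf (x : R) : `]t - 1, t + 1[%classic x -> mu.-integrable setT (EFin \o f x).
  by move=> _; exact: int_cos.
have derf1 (u y : R) : `]t - 1, t + 1[%classic u -> [set: measurableTypeR R] y ->
    derivable (f^~ y) u 1.
  by move=> _ _; have [] := is_derive_cos d y u.
have intG : mu.-integrable setT (EFin \o G).
  apply: (integrable_normal_quadratic s0 (g := fun x => `|x - m|) (C := 1)).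
    by apply: measurableT_comp => //; exact: measurable_funB.
  by move=> x; rewrite normr_id mul1r ler_norm_1Dsqr.
have dfE (u y : R) : partial1of2 f u y = - (y - m) * sin (u * (y - m) + d) * p y.
  by rewrite partial1of2E; have [_ ->] := is_derive_cos d y u.
have Gub (u y : R) : `]t - 1, t + 1[%classic u -> [set: measurableTypeR R] y ->
    `|partial1of2 f u y| <= G y.
  move=> _ _; rewrite dfE !normrM normrN (ger0_norm (normal_pdf_ge0 _ _ _)).
  rewrite ler_wpM2r ?normal_pdf_ge0// ler_piMr//.
  by rewrite ler_norml sin_geN1 sin_le1.
have dphi := derivable_under_integral measurableT It intf derf1 Gge0 intG Gub.
have vphi := differentiation_under_integral measurableT It intf derf1 Gge0 intG Gub.
apply: DeriveDef; first exact: dphi.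
rewrite -derive1E vphi.
under eq_Rintegral do rewrite dfE.
have dsin (x : R) : is_derive x (1 : R) (fun x => sin (t * (x - m) + d))
    (t * cos (t * (x - m) + d)).
  by apply: is_derive_eq; rewrite /GRing.scale/= /GRing.scale/=; ring.
(* The constant [1 + |t|] covers both the bound 1 on the sine and the bound [|t|] on its derivative.
   Stein's identity turns the derivative of [phi] back into a multiple of [phi]. *)
have := @normal_pdf_stein _ m s s0 (fun x => sin (t * (x - m) + d))
  (fun x => t * cos (t * (x - m) + d)) (1 + `|t|) dsin.
move=> bp.
transitivity (- \int[mu]_x ((x - m) * sin (t * (x - m) + d) * p x)).
  transitivity (\int[mu]_x (-1 * ((x - m) * sin (t * (x - m) + d) * p x))).
    by apply: eq_Rintegral => x _; ring.
  rewrite RintegralZl ?mulN1r//.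
  apply: (@integrable_normal_quadratic _ _ _ s0
    (fun x => (x - m) * sin (t * (x - m) + d)) 1).
    by apply: measurable_funM; [exact: measurable_funB|exact: measurable_sinl].
  move=> x; rewrite normrM mul1r.
  apply: (@le_trans _ _ `|x - m|).
    by rewrite ler_piMr// ler_norml sin_geN1 sin_le1.
  exact: ler_norm_1Dsqr.
rewrite bp; last 3 first.
- move=> x; apply: cvgM; first exact: cvg_cst.
  apply: (@continuous_comp _ _ _ (fun x => t * (x - m) + d) cos).
    apply: cvgD; last exact: cvg_cst.
    apply: cvgM; first exact: cvg_cst.
    by apply: cvgB => //; exact: cvg_cst.
  exact: continuous_cos.
- move=> x; apply: (@le_trans _ _ 1).
    by rewrite ler_norml sin_geN1 sin_le1.
  have := normr_ge0 t; have := normr_ge0 (x - m).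
  by move: `|t| `|x - m| => a b a0 b0; nra.
- move=> x; rewrite normrM (@le_trans _ _ `|t|)//.
    by rewrite ler_piMr// ler_norml cos_geN1 cos_le1.
  by rewrite lerDr.
rewrite mulNr -(mulrA (s ^+ 2)); congr (- (_ * _)).
rewrite -RintegralZl//; last exact: int_cos.
by apply: eq_Rintegral => x _; rewrite mulrA.
Qed.

Lemma normal_pdf_cos (t d : R) :
  \int[mu]_x (cos (t * (x - m) + d) * p x) =
  cos d * expR (- (s ^+ 2 * t ^+ 2 / 2)).
Proof.
(* Integrating factor of [phi' = - s^2 t phi]: [h] is constant, and its value at 0 is [cos d]. *)
pose h t := phi d t * expR (s ^+ 2 * t ^+ 2 / 2).
have dh (u : R) : is_derive u (1 : R) h 0.
  have ? := phi_derive d u.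
  by apply: is_derive_eq; rewrite /GRing.scale/= /GRing.scale/=; field.
have := @is_derive_0_is_cst _ h t 0 dh.
rewrite /h expr0n/= mulr0 mul0r expR0 mulr1.
have -> : phi d 0 = cos d.
  rewrite /phi; under eq_Rintegral do rewrite mul0r add0r.
  by rewrite RintegralZl ?Rintegral_pdf ?mulr1//; exact: integrable_normal_pdf.
by move=> <-; rewrite -[RHS]mulrA -expRD subrr expR0 mulr1.
Qed.

Lemma normal_pdf_mean : \int[mu]_x (x * p x) = m.
Proof.
have := @normal_pdf_stein _ m s s0 (cst 1) (cst 0) 1.
rewrite /= => bp.
transitivity (\int[mu]_x ((x - m) * 1 * p x + m * p x)).
  by apply: eq_Rintegral => x _; ring.
rewrite RintegralD//; last 2 first.
- apply: (@integrable_normal_quadratic _ _ _ s0 (fun x => (x - m) * 1) 1).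
    by apply: measurable_funM => //; exact: measurable_funB.
  by move=> x; rewrite mulr1 mul1r ler_norm_1Dsqr.
- rewrite /comp; under eq_fun do rewrite EFinM.
  by apply: integrableZl => //; exact: integrable_normal_pdf.
rewrite bp//.
- under [X in _ * X + _]eq_Rintegral do rewrite mul0r.
  rewrite Rintegral_cst// mul0r mulr0 add0r RintegralZl ?Rintegral_pdf ?mulr1//.
  exact: integrable_normal_pdf.
- by move=> x; exact: cvg_cst.
- by move=> x; rewrite normr1 mul1r lerDl.
- by move=> x; rewrite normr0.
Qed.

Lemma normal_pdf_variance : \int[mu]_x ((x - m) ^+ 2 * p x) = s ^+ 2.
Proof.
transitivity (\int[mu]_x ((x - m) * (x - m) * p x)).
  by apply: eq_Rintegral => x _; rewrite expr2.
have dg (x : R) : is_derive x (1 : R) (fun x => x - m) (cst 1 x).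
  by apply: is_derive_eq; rewrite subr0.
rewrite (@normal_pdf_stein _ m s s0 (fun x => x - m) (cst 1) 1 dg).
- under eq_Rintegral do rewrite mul1r.
  by rewrite Rintegral_pdf mulr1.
- by move=> x; exact: cvg_cst.
- by move=> x; rewrite mul1r lerDr.
- by move=> x; rewrite normr1.
Qed.

End normal_char.

(** * Changing variables and independence *)

Section weighted_transfer.
Import HBNNSimple.
Local Open Scope ereal_scope.
Context d d' d'' (T : measurableType d) (T' : measurableType d')
  (S : measurableType d'') (R : realType).
Variables (mu : {measure set T -> \bar R}) (nu : {measure set T' -> \bar R}).
Variables (w : T -> R) (Y : T -> S) (Z : T' -> S) (c : R).
Hypotheses (mw : measurable_fun setT w) (w0 : forall x, (0 <= w x)%R).
Hypotheses (mY : measurable_fun setT Y) (mZ : measurable_fun setT Z).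
Hypothesis wYZ : forall A, measurable A ->
  \int[mu]_x (w x * \1_A (Y x))%:E = c%:E * nu (Z @^-1` A).

(** From indicators to simple functions, then to nonnegative functions by monotone convergence.
    Weight and constant are both kept so that one statement covers laws with a density ([w] the
    density, [c = 1]) and independence ([mu = nu = P], [w] built from other variables, [c] its
    mean). *)
Lemma ge0_weighted_transfer (f : S -> R) :
  measurable_fun setT f -> (forall y, (0 <= f y)%R) ->
  \int[mu]_x (w x * f (Y x))%:E = c%:E * \int[nu]_x (f (Z x))%:E.
Proof.
move=> mf f0.
have mEf : measurable_fun [set: S] (EFin \o f) by exact/measurable_EFinP.
pose f_ := nnsfun_approx measurableT mEf.
have mf_Y n : measurable_fun setT (f_ n \o Y) by exact: measurableT_comp.
have mf_Z n : measurable_fun setT (f_ n \o Z) by exact: measurableT_comp.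
have cvf y : (f_ n y)%:E @[n --> \oo] --> (f y)%:E.
  by apply: cvg_nnsfun_approx => // *; rewrite lee_fin.
have ndf y m n : (m <= n)%N -> (f_ m y <= f_ n y)%R.
  by move=> mn; exact/lefP/nd_nnsfun_approx.
transitivity (limn (fun n => \int[mu]_x (w x * f_ n (Y x))%:E)).
  rewrite -monotone_convergence//.
  - apply: eq_integral => x _; apply/esym/cvg_lim => //.
    under eq_fun do rewrite EFinM.
    by rewrite EFinM; apply: cvgeZl => //; exact: cvf.
  - by move=> n; apply/measurable_EFinP/measurable_funM => //; exact: mf_Y.
  - by move=> n x _; rewrite lee_fin mulr_ge0.
  - by move=> x _ m n mn; rewrite lee_fin ler_wpM2l// ndf.
transitivity (limn (fun n => c%:E * \int[nu]_x (f_ n (Z x))%:E)); last first.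
  transitivity (c%:E * limn (fun n => \int[nu]_x (f_ n (Z x))%:E)).
    apply/cvg_lim => //; apply: cvgeZl => //.
    apply: ereal_nondecreasing_is_cvgn => n m nm; apply: ge0_le_integral => //.
    - by move=> x _; rewrite lee_fin.
    - by apply/measurable_EFinP; exact: mf_Z.
    - by apply/measurable_EFinP; exact: mf_Z.
    - by move=> x _; rewrite lee_fin ndf.
  congr (_ * _).
  rewrite -monotone_convergence//.
  - by apply: eq_integral => x _; apply/cvg_lim => //; exact: cvf.
  - by move=> n; apply/measurable_EFinP; exact: mf_Z.
  - by move=> n x _; rewrite lee_fin.
  - by move=> x _ m n mn; rewrite lee_fin ndf.
congr (limn _); apply/funext => n.
have mA r : measurable (f_ n @^-1` [set r]) by [].
transitivity (\sum_(k \in range (f_ n))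
    \int[mu]_x (k * (w x * \1_(f_ n @^-1` [set k]) (Y x)))%:E).
  rewrite -ge0_integral_fsum//.
  - apply: eq_integral => x _; rewrite fsumEFin//; congr EFin.
    rewrite [in LHS](fimfunE (f_ n) (Y x)) mulr_fsumr//.
    by apply: eq_fsbigr => k _; rewrite mulrCA.
  - move=> r; apply/measurable_EFinP; apply: measurable_funM => //.
    by apply: measurable_funM => //; exact: measurableT_comp.
  - move=> r x _; rewrite lee_fin mulrCA mulr_ge0//.
    by have := nnfun_muleindic_ge0 (f_ n) r (Y x); rewrite lee_fin.
transitivity (\sum_(k \in range (f_ n))
    c%:E * \int[nu]_x (k * (\1_(f_ n @^-1` [set k]) (Z x)))%:E); last first.
  rewrite -ge0_mule_fsumr; last first.
    move=> r; apply: integral_ge0 => x _.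
    by have := nnfun_muleindic_ge0 (f_ n) r (Z x); rewrite lee_fin.
  congr (_ * _); rewrite -ge0_integral_fsum//.
  - by apply: eq_integral => x _; rewrite fsumEFin// -fimfunE.
  - move=> r; apply/measurable_EFinP; apply: measurable_funM => //.
    exact: measurableT_comp.
  - by move=> r x _; exact: nnfun_muleindic_ge0.
(* Only values in the range of [f_ n] occur; they are nonnegative, so they can be pulled out of the
   integrals. *)
apply: eq_fsbigr => k /set_mem [y _ <-].
have k0 : (0 <= f_ n y)%R by [].
transitivity ((f_ n y)%:E * \int[mu]_x (w x * \1_(f_ n @^-1` [set f_ n y]) (Y x))%:E).
  under eq_integral do rewrite EFinM.
  rewrite ge0_integralZl//.
    apply/measurable_EFinP/measurable_funM => //; exact: measurableT_comp.
  by move=> x _; rewrite lee_fin mulr_ge0.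
rewrite wYZ// muleCA; congr (_ * _).
under [RHS]eq_integral do rewrite EFinM.
rewrite ge0_integralZl//.
- congr (_ * _).
  have mB : measurable (Z @^-1` (f_ n @^-1` [set f_ n y])).
    by rewrite -[X in measurable X]setTI; exact: mZ.
  transitivity (\int[nu]_x (\1_(Z @^-1` (f_ n @^-1` [set f_ n y])) x)%:E).
    by rewrite integral_indic// setIT.
  by apply: eq_integral => x _.
- by apply/measurable_EFinP; exact: measurableT_comp.
Qed.

End weighted_transfer.

Section transfer.
Context d d' d'' (T : measurableType d) (T' : measurableType d')
  (S : measurableType d'') (R : realType).
Variables (mu : {measure set T -> \bar R}) (nu : {measure set T' -> \bar R}).
Variables (w : T -> R) (Y : T -> S) (Z : T' -> S).
Hypotheses (mw : measurable_fun setT w) (w0 : forall x, 0 <= w x).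
Hypotheses (mY : measurable_fun setT Y) (mZ : measurable_fun setT Z).
Hypothesis wYZ : forall A, measurable A ->
  (\int[mu]_x (w x * \1_A (Y x))%:E = nu (Z @^-1` A))%E.

Lemma Rintegral_weighted_transfer (f : S -> R) :
  measurable_fun setT f -> mu.-integrable setT (fun x => (w x * f (Y x))%:E) ->
  nu.-integrable setT (fun x => (f (Z x))%:E) /\
  \int[nu]_x f (Z x) = \int[mu]_x (w x * f (Y x)).
Proof.
move=> mf intf.
have tr (g : S -> R) : measurable_fun setT g -> (forall y, 0 <= g y) ->
    (\int[nu]_x (g (Z x))%:E = \int[mu]_x (w x * g (Y x))%:E)%E.
  move=> mg g0.
  rewrite (@ge0_weighted_transfer _ _ _ _ _ _ _ mu nu w Y Z 1) ?mul1e// => A mA.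
  by rewrite mul1e wYZ.
have mfZ : measurable_fun setT (fun x => f (Z x)) by exact: measurableT_comp.
have mfY : measurable_fun setT (fun x => f (Y x)) by exact: measurableT_comp.
have intnu (g : S -> R) : measurable_fun setT g ->
    mu.-integrable setT (fun x => (w x * g (Y x))%:E) ->
    nu.-integrable setT (fun x => (g (Z x))%:E).
  move=> mg /integrableP[_ ifin]; apply/integrableP; split.
    by apply/measurable_EFinP; exact: measurableT_comp.
  rewrite (_ : (\int[nu]_x _ = \int[nu]_x (`|g (Z x)|%:E))%E)//.
  rewrite (tr (fun y => `|g y|))//; last exact: measurableT_comp.
  move: ifin; congr (_ < _)%E; apply: eq_integral => x _ /=.
  by rewrite normrM ger0_norm.
have intnuf := intnu _ mf intf.
split => //.
pose fp y := Num.max (f y) 0; pose fn y := Num.max (- f y) 0.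
have mfp : measurable_fun setT fp by apply: measurable_maxr.
have mfn : measurable_fun setT fn.
  by apply: measurable_maxr => //; exact: measurableT_comp.
have fpn y : f y = fp y - fn y.
  rewrite /fp /fn; case: (leP 0 (f y)) => f0.
    by rewrite max_r ?oppr_le0// subr0.
  by rewrite max_l ?oppr_ge0 1?ltW// sub0r opprK.
have ipart (g : S -> R) : measurable_fun setT g -> (forall y, `|g y| <= `|f y|) ->
    mu.-integrable setT (fun x => (w x * g (Y x))%:E).
  move=> mg gf; apply: (le_integrable measurableT _ _ intf).
    apply/measurable_EFinP/measurable_funM => //; exact: measurableT_comp.
  by move=> x _; rewrite lee_fin/= !normrM ler_wpM2l.
have ifp : mu.-integrable setT (fun x => (w x * fp (Y x))%:E).
  apply: ipart => // y; rewrite /fp; case: (leP (f y) 0) => // _.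
  by rewrite normr0.
have ifn : mu.-integrable setT (fun x => (w x * fn (Y x))%:E).
  apply: ipart => // y; rewrite /fn; case: (leP (- f y) 0) => // _.
    by rewrite normr0.
  by rewrite normrN.
transitivity (\int[nu]_x (fp (Z x) - fn (Z x))).
  by apply: eq_Rintegral => x _.
rewrite RintegralB//; [|exact: (intnu fp)|exact: (intnu fn)].
transitivity (\int[mu]_x (w x * fp (Y x) - w x * fn (Y x))); last first.
  by apply: eq_Rintegral => x _; rewrite -mulrBr -fpn.
rewrite RintegralB//; congr (_ - _); rewrite /Rintegral tr// => y.
  by rewrite /fp le_max lexx orbT.
by rewrite /fn le_max lexx orbT.
Qed.

End transfer.

(** Uncorrelatedness of [w] with the events of [Y] extends to bounded functions of [Y]. Here [w] and
    [f] are signed while the transfer lemma is for nonnegative ones: both are shifted by their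
    bounds, and the additional terms cancel by linearity. *)
Lemma expectation_weighted d (T : measurableType d) (R : realType)
    (P : probability T R) (w Y : T -> R) (c M N : R) (f : R -> R) :
  measurable_fun setT w -> (forall x, `|w x| <= M) ->
  measurable_fun setT Y ->
  (forall A, measurable A ->
    \int[P]_x (w x * \1_A (Y x)) = c * \int[P]_x \1_A (Y x)) ->
  measurable_fun setT f -> (forall y, `|f y| <= N) ->
  \int[P]_x (w x * f (Y x)) = c * \int[P]_x f (Y x).
Proof.
move=> mw wM mY wY mf fN.
have iw : P.-integrable setT (EFin \o w) by exact: (integrable_bounded P mw wM).
have mfY : measurable_fun setT (fun x => f (Y x)) by exact: measurableT_comp.
have ifY : P.-integrable setT (EFin \o (fun x => f (Y x))).
  by apply: (@integrable_bounded _ _ _ P N).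
have iwf : P.-integrable setT (EFin \o (fun x => w x * f (Y x))).
  apply: (@integrable_bounded _ _ _ P (M * N)); first exact: measurable_funM.
  by move=> x; rewrite normrM ler_pM.
have icst r : P.-integrable setT (EFin \o cst r).
  by apply: (@integrable_bounded _ _ _ P `|r|).
have PT : fine (P setT) = 1 by rewrite probability_setT.
(* The case [A = setT] identifies [c]; this is what cancels the term [N * w] produced by the
   shift. *)
have Ew : \int[P]_x w x = c.
  have := wY setT measurableT; under eq_Rintegral do rewrite indicT mulr1.
  move=> ->; under eq_Rintegral do rewrite indicT.
  by rewrite Rintegral_cst//= PT !mulr1.
have ind A : measurable A -> measurable_fun setT (fun x => \1_A (Y x) : R).
  by move=> mA; apply: measurableT_comp.
have iind A : measurable A -> P.-integrable setT (EFin \o (fun x => \1_A (Y x) : R)).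
  move=> mA; apply: (@integrable_bounded _ _ _ P 1); first exact: ind.
  by move=> x; rewrite indicE; case: (_ \in _); rewrite ?normr1 ?normr0.
have fN0 (y : R) : 0 <= f y + N.
  by have := fN y; rewrite ler_norml => /andP[]; lra.
have tr : (\int[P]_x ((w x + M) * (f (Y x) + N))%:E =
    (c + M)%:E * \int[P]_x (f (Y x) + N)%:E)%E.
  apply: (@ge0_weighted_transfer _ _ _ _ _ _ _ P P (fun x => w x + M) Y Y (c + M)
      _ _ mY mY _ (fun y => f y + N)).
  - exact: measurable_funD.
  - by move=> x; have := wM x; rewrite ler_norml => /andP[]; lra.
  - move=> A mA.
    rewrite -[RHS]fineK; last first.
      rewrite fin_numM// fin_num_measure// -[X in measurable X]setTI.
      exact: mY.
    rewrite -[LHS]fineK; last first.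
      apply: integrable_fin_num => //.
      apply: (@integrable_bounded _ _ _ P (`|M| + `|M|)).
        by apply: measurable_funM; [exact: measurable_funD|exact: ind].
      move=> x /=; rewrite indicE; case: (_ \in _); rewrite ?mulr1 ?mulr0 ?normr0//.
        rewrite (le_trans (ler_normD _ _))// lerD2r.
        by rewrite (le_trans (wM x))// ler_norm.
    congr EFin; rewrite -/(Rintegral P setT (fun x => (w x + M) * \1_A (Y x))).
    under eq_Rintegral do rewrite mulrDl.
    rewrite RintegralD//; last 2 first.
      apply: (@integrable_bounded _ _ _ P M).
        by apply: measurable_funM => //; exact: ind.
      move=> x /=; rewrite indicE; case: (_ \in _); rewrite ?mulr1 ?mulr0 ?normr0//.
      exact: le_trans (wM x).
      rewrite /comp; under eq_fun do rewrite EFinM.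
      by apply: integrableZl => //; exact: iind.
    rewrite wY// RintegralZl//; last exact: iind.
    rewrite -mulrDl fineM//; last first.
      by rewrite fin_num_measure// -[X in measurable X]setTI; exact: mY.
    congr (_ * _); rewrite /Rintegral.
    transitivity (fine (\int[P]_x (\1_(Y @^-1` A) x)%:E)).
      by congr fine; apply: eq_integral.
    by rewrite integral_indic ?setIT// -[X in measurable X]setTI; exact: mY.
  - exact: measurable_funD.
  - exact: fN0.
have ifN : P.-integrable setT (EFin \o (fun x => f (Y x) + N)).
  by rewrite /comp; under eq_fun do rewrite EFinD; apply: integrableD => //; exact: (icst N).
move/(congr1 fine) : tr; rewrite fineM//; last exact: integrable_fin_num ifN.
rewrite -/(Rintegral P setT (fun x => (w x + M) * (f (Y x) + N))).
rewrite -/(Rintegral P setT (fun x => f (Y x) + N)) /= RintegralD//; last exact: (icst N).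
rewrite Rintegral_cst// PT mulr1.
have iMf : P.-integrable setT (EFin \o (fun x => M * f (Y x))).
  by rewrite /comp; under eq_fun do rewrite EFinM; apply: integrableZl.
have iNw : P.-integrable setT (EFin \o (fun x => N * w x)).
  by rewrite /comp; under eq_fun do rewrite EFinM; apply: integrableZl.
rewrite (_ : \int[P]_x ((w x + M) * (f (Y x) + N)) =
  \int[P]_x ((w x * f (Y x) + M * f (Y x)) + (N * w x + cst (M * N) x))); last first.
  by apply: eq_Rintegral => x _ /=; ring.
rewrite RintegralD//; last 2 first.
  by rewrite /comp; under eq_fun do rewrite EFinD; apply: integrableD.
  by rewrite /comp; under eq_fun do rewrite EFinD; apply: integrableD => //; exact: (icst (M * N)).
have Ecst r : \int[P]_x cst r x = r by rewrite Rintegral_cst// PT mulr1.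
rewrite !RintegralD//.
rewrite Ecst !RintegralZl// Ew.
by move=> h; lra.
Qed.

(** * Integrals of functions of a normal variable *)

Section is_normal_theory.
Context d (T : measurableType d) (R : realType) (P : probability T R).
Variables (Y : T -> R) (m s : R).
Hypotheses (mY : measurable_fun setT Y) (nY : is_normal P Y m s).

Lemma Rintegral_is_normal (f : R -> R) : s != 0 ->
  measurable_fun setT f ->
  lebesgue_measure.-integrable setT (fun x => (f x * normal_pdf m s x)%:E) ->
  P.-integrable setT (fun x => (f (Y x))%:E) /\
  \int[P]_x f (Y x) = \int[lebesgue_measure]_x (f x * normal_pdf m s x).
Proof.
move=> s0 mf intf.
have [] := @Rintegral_weighted_transfer _ _ _ _ _ _ _ (@lebesgue_measure R) P
  (normal_pdf m s) id Y _ _ _ mY _ f.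
- exact: measurable_normal_pdf.
- exact: normal_pdf_ge0.
- exact: measurable_id.
- move=> A mA; apply: etrans (esym (nY mA)); rewrite (negbTE s0) /normal_prob.
  rewrite [RHS]integral_mkcond; apply: eq_integral => x _.
  by rewrite patchE indicE; case: (x \in A); rewrite ?mulr1 ?mulr0.
- exact: mf.
- by under eq_fun do rewrite mulrC.
move=> iY ->; split => //.
by apply: eq_Rintegral => x _; rewrite mulrC.
Qed.

(** The same transfer, from the Dirac mass at [m] with weight 1. Integrability is automatic because
    only the value [f m] matters. *)
Lemma Rintegral_is_normal0 (f : R -> R) : s = 0 -> measurable_fun setT f ->
  P.-integrable setT (fun x => (f (Y x))%:E) /\ \int[P]_x f (Y x) = f m.
Proof.
move=> s0 mf.
have [] := @Rintegral_weighted_transfer _ _ _ _ _ _ _ (\d_m : {measure set R -> \bar R}) P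
  (cst 1) id Y _ _ _ mY _ f.
- exact: measurable_cst.
- by move=> x /=.
- exact: measurable_id.
- move=> A mA; apply: etrans (esym (nY mA)); rewrite s0 eqxx.
  under eq_integral do rewrite mul1r.
  by rewrite integral_indic// setIT.
- exact: mf.
- apply/integrableP; split.
    by apply/measurable_EFinP; apply: measurable_funM.
  rewrite integral_dirac//; first by rewrite diracE in_setT mul1e /= ltry.
  apply: measurableT_comp => //; apply/measurable_EFinP.
  exact: measurable_funM.
move=> iY ->; split => //.
rewrite /Rintegral integral_dirac//.
  by rewrite diracE in_setT mul1e /= mul1r.
by apply/measurable_EFinP; exact: measurable_funM.
Qed.

Lemma Rintegral_cos_is_normal (t e : R) :
  \int[P]_x cos (t * Y x + e) = cos (t * m + e) * expR (- (s ^+ 2 * t ^+ 2 / 2)).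
Proof.
have mcos : measurable_fun setT (fun x : R => cos (t * x + e)).
  apply: measurableT_comp.
    exact: continuous_measurable_fun (@continuous_cos R).
  by apply: measurable_funD => //; exact: measurable_funM.
have [s0|s0] := eqVneq s 0.
  have [_ ->] := Rintegral_is_normal0 s0 mcos.
  by rewrite s0 expr0n/= !mul0r oppr0 expR0 mulr1.
have [|_ ->] := Rintegral_is_normal s0 mcos.
  apply: (integrable_normal_quadratic s0 mcos (C := 1)) => x.
  rewrite mul1r (@le_trans _ _ 1) ?ler_norml ?cos_geN1 ?cos_le1//.
  by rewrite lerDl sqr_ge0.
rewrite -(normal_pdf_cos m s0); apply: eq_Rintegral => x _.
by congr (cos _ * _); ring.
Qed.

Lemma is_normal_moments :
  [/\ P.-integrable setT (fun x => (Y x)%:E),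
      P.-integrable setT (fun x => (Y x ^+ 2)%:E),
      \int[P]_x Y x = m & \int[P]_x (Y x - m) ^+ 2 = s ^+ 2].
Proof.
have mi : measurable_fun setT (fun x : R => x) by exact: measurable_id.
have mc : measurable_fun setT (fun x : R => (x - m) ^+ 2).
  by apply: measurable_funX; exact: measurable_funB.
have mq : measurable_fun setT (fun x : R => x ^+ 2) by exact: measurable_funX.
have [s0|s0] := eqVneq s 0.
  have [i1 e1] := Rintegral_is_normal0 s0 mi.
  have [i2 e2] := Rintegral_is_normal0 s0 mc.
  have [i3 e3] := Rintegral_is_normal0 s0 mq.
  by split => //; rewrite e2 subrr s0.
(* From [x^2 <= 2 (x - m)^2 + 2 m^2], that is [(x - 2 m)^2 >= 0]. *)
have q2 (x : R) : `|x ^+ 2| <= (2 + 2 * m ^+ 2) * (1 + (x - m) ^+ 2).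
  rewrite ger0_norm ?sqr_ge0//.
  have := sqr_ge0 (x - 2 * m); have := sqr_ge0 m; have := sqr_ge0 (x - m).
  by move=> h1 h2 h3; have := mulr_ge0 h1 h2; nra.
have q1 (x : R) : `|x| <= (1 + (2 + 2 * m ^+ 2)) * (1 + (x - m) ^+ 2).
  rewrite (le_trans (ler_norm_1Dsqr _))// mulrDl lerD//.
    by rewrite mul1r lerDl sqr_ge0.
  exact: le_trans (ler_norm _) (q2 x).
have [i1 e1] := Rintegral_is_normal s0 mi (integrable_normal_quadratic s0 mi q1).
have qc (x : R) : `|(x - m) ^+ 2| <= 1 * (1 + (x - m) ^+ 2).
  by rewrite ger0_norm ?sqr_ge0// mul1r lerDr.
have [i2 e2] := Rintegral_is_normal s0 mc (integrable_normal_quadratic s0 mc qc).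
have [i3 e3] := Rintegral_is_normal s0 mq (integrable_normal_quadratic s0 mq q2).
split => //; first by rewrite e1 normal_pdf_mean.
by rewrite e2 normal_pdf_variance.
Qed.

End is_normal_theory.

(** * Gaussian processes *)

(** A Gaussian process only promises some mean [m] and some [s] for each linear combination.
    Computing the first two moments of the combination forces [m = 0] and [s^2] equal to the
    quadratic form of [C]. *)
Lemma Rintegral_cos_gaussian_process d (T : measurableType d) (R : realType)
    (P : probability T R) (X : R -> {RV P >-> R}) (C : R -> R -> R)
    (n : nat) (t a : 'I_n -> R) (e : R) :
  centered_gaussian_process X C -> (forall i, 0 <= t i) ->
  \int[P]_w cos (\sum_(i < n) a i * X (t i) w + e) =
  cos e * expR (- ((\sum_(i < n) \sum_(j < n) a i * a j * C (t i) (t j)) / 2)).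
Proof.
move=> [gX eX cX] t0.
have mX u : measurable_fun setT (X u : T -> R) by [].
have iX u : 0 <= u -> P.-integrable setT (EFin \o X u) /\
    P.-integrable setT (EFin \o (fun w => X u w ^+ 2)).
  (* One-point combinations give square integrability of each [X u], which is what allows the
     moments of a sum to be expanded. *)
  move=> u0; have [//|m [s nX]] := gX 1%N (fun=> u) (fun=> 1).
  have nX' : is_normal P (X u) m s.
    move: nX; rewrite (_ : (fun w => _) = X u)//.
    by apply/funext => w; rewrite big_ord1 mul1r.
  by have [] := is_normal_moments (mX u) nX'.
have EX u : 0 <= u -> \int[P]_w X u w = 0.
  by move=> u0; have := eX u u0; rewrite expectation_def /Rintegral => ->.
have iXX u v : 0 <= u -> 0 <= v ->
    P.-integrable setT (EFin \o (fun w => X u w * X v w)).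
  move=> u0 v0; have [_ i1] := iX u u0; have [_ i2] := iX v v0.
  apply: (@le_integrable _ _ R P setT _ _
    (fun w => (X u w ^+ 2)%:E + (X v w ^+ 2)%:E)%E) => //.
  - by apply/measurable_EFinP; exact: measurable_funM.
  - move=> w _; rewrite /= lee_fin [leRHS]ger0_norm ?addr_ge0 ?sqr_ge0//.
    rewrite normrM -(real_normK (num_real (X u w))) -(real_normK (num_real (X v w))).
    move: (normr_ge0 (X u w)) (normr_ge0 (X v w)).
    move: `|X u w| `|X v w| => x y x0 y0; have := sqr_ge0 (x - y); nra.
  - exact: integrableD.
have CX u v : 0 <= u -> 0 <= v -> \int[P]_w (X u w * X v w) = C u v.
  move=> u0 v0; have := cX u v u0 v0.
  rewrite covariance.unlock (eX _ u0) (eX _ v0) /= expectation.unlock => /(congr1 fine) /= <-.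
  congr fine; apply: eq_integral => w _ /=; congr EFin.
  by rewrite !fctE /= !subr0.
pose Y w := \sum_(i < n) a i * X (t i) w.
have mY : measurable_fun setT Y.
  by apply: measurable_sum => i; exact: measurable_funM.
have [m [s nY]] := gX n t a t0.
have [_ _ mean var] := is_normal_moments mY nY.
have m0 : m = 0.
  rewrite -mean /Y; have [i|_ ->] := @Rintegral_sum _ T R P setT _
    (index_enum 'I_n) (fun i w => a i * X (t i) w) measurableT.
    have [i1 _] := iX _ (t0 i).
    by rewrite /comp; under eq_fun do rewrite EFinM; apply: integrableZl.
  rewrite big1// => i _; rewrite RintegralZl// ?EX ?mulr0//.
  by have [] := iX _ (t0 i).
have s2 : s ^+ 2 = \sum_(i < n) \sum_(j < n) a i * a j * C (t i) (t j).
  rewrite -var m0.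
  under eq_Rintegral do rewrite subr0.
  have iff (i j : 'I_n) := iXX _ _ (t0 i) (t0 j).
  have sqrE := @Rintegral_sqr_sum _ _ _ P setT n a _ measurableT iff.
  rewrite /= in sqrE; rewrite /Y sqrE.
  by apply: eq_bigr => i _; apply: eq_bigr => j _; rewrite CX.
have := Rintegral_cos_is_normal mY nY 1 e.
by rewrite s2 m0 mulr0 add0r expr1n mulr1 => <-; apply: eq_Rintegral => w _; rewrite mul1r.
Qed.

(** Quantifying the hypothesis over [e] packs two facts: [b i * Y i] has mean cosine [v i] and mean
    sine 0. The sine term of each addition formula therefore drops out, and a plain product
    remains. *)
Lemma Rintegral_cos_independent d (T : measurableType d) (R : realType)
    (P : probability T R) (n : nat) (Y : 'I_n -> T -> R) (b v : 'I_n -> R) :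
  (forall i, measurable_fun setT (Y i)) -> independent_family P Y ->
  (forall i e, \int[P]_w cos (b i * Y i w + e) = cos e * v i) ->
  forall e, \int[P]_w cos (\sum_(i < n) b i * Y i w + e) =
    cos e * \prod_(i < n) v i.
Proof.
move=> mY indY Yv e.
have mcos (f : T -> R) : measurable_fun setT f -> measurable_fun setT (cos \o f).
  move=> mf; apply: measurableT_comp => //.
  exact: continuous_measurable_fun (@continuous_cos R).
have mind i A : measurable A -> measurable_fun setT (fun x => \1_A (Y i x) : R).
  by move=> mA; apply: measurableT_comp.
have indic01 A (x : R) : 0 <= (\1_A x : R) <= 1.
  by rewrite indicE; case: (_ \in _); rewrite /= lexx ler01.
have prod01 (p : pred 'I_n) (A : 'I_n -> set R) w :
    `|\prod_(i < n | p i) (\1_(A i) (Y i w) : R)| <= 1.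
  rewrite ger0_norm; last by apply: prodr_ge0 => i _; have /andP[] := indic01 (A i) (Y i w).
  by apply: prodr_ile1 => i _; exact: indic01.
have mprod (p : pred 'I_n) (A : 'I_n -> set R) : (forall i, measurable (A i)) ->
    measurable_fun setT (fun w => \prod_(i < n | p i) (\1_(A i) (Y i w) : R)).
  move=> mA; under eq_fun do rewrite big_mkcond.
  apply: measurable_prod => i _; case: (p i); last exact: measurable_cst.
  exact: mind.
(* Indicators of the Y_i are turned into cosines one variable at a time: the
   product rule for sets is what lets the k-th variable be integrated apart. *)
have key (k : nat) : (k <= n)%N -> forall (e : R) (A : 'I_n -> set R),
    (forall i, measurable (A i)) ->
    \int[P]_w (cos (\sum_(i < n | (i < k)%N) b i * Y i w + e) *
      \prod_(i < n | (k <= i)%N) \1_(A i) (Y i w)) =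
    cos e * \prod_(i < n | (i < k)%N) v i *
      \prod_(i < n | (k <= i)%N) \int[P]_w \1_(A i) (Y i w).
  elim: k => [_ {}e A mA|k IH kn {}e A mA].
    rewrite [in RHS]big_pred0_eq mulr1.
    under eq_Rintegral do rewrite big_pred0_eq add0r.
    rewrite RintegralZl//; last first.
      by apply: (@integrable_bounded _ _ _ P 1) => //; exact: mprod.
    congr (_ * _).
    have PE i : \int[P]_w \1_(A i) (Y i w) = fine (P (Y i @^-1` A i)).
      rewrite /Rintegral; congr fine.
      transitivity (\int[P]_w (\1_(Y i @^-1` A i) w)%:E)%E.
        by apply: eq_integral.
      by rewrite integral_indic ?setIT// -[X in measurable X]setTI; exact: mY.
    transitivity (fine (P (\bigcap_(i in [set: 'I_n]) (Y i @^-1` A i)))).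
      rewrite /Rintegral; congr fine.
      transitivity (\int[P]_w (\1_(\bigcap_(i in [set: 'I_n]) (Y i @^-1` A i)) w)%:E)%E.
        apply: eq_integral => w _; congr EFin; rewrite indicE.
        have [|] := boolP (w \in _).
          rewrite inE => wA; rewrite big1// => i _; rewrite indicE mem_set//.
          exact: wA.
        move=> /negP wA; apply/eqP/prodf_eq0 => /=.
        apply: contrapT => h; apply: wA; rewrite inE => i _ /=.
        apply: contrapT => nA; apply: h; exists i => //.
        by rewrite indicE memNset.
      rewrite integral_indic ?setIT//.
      apply: fin_bigcap_measurable; first exact: finite_finset.
      by move=> i _; rewrite -[X in measurable X]setTI; exact: mY.
    rewrite indY//.
    under [RHS]eq_bigr do rewrite PE.
    rewrite (eq_bigr (fun i => (fine (P (Y i @^-1` A i)))%:E)); last first.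
      move=> i _; rewrite fineK// fin_num_measure//.
      by rewrite -[X in measurable X]setTI; exact: mY.
    by rewrite -(big_morph EFin (@EFinM R) erefl).
  pose o := Ordinal kn.
  have eqp (i : 'I_n) : (k <= i)%N && (i != o) = (k < i)%N.
    by rewrite ltn_neqAle andbC -val_eqE/= eq_sym.
  have eqs (i : 'I_n) : (i < k.+1)%N && (i != o) = (i < k)%N.
    by rewrite [RHS]ltn_neqAle ltnS andbC -val_eqE.
  pose S w := \sum_(i < n | (i < k)%N) b i * Y i w.
  pose Q w := \prod_(i < n | (k < i)%N) (\1_(A i) (Y i w) : R).
  pose c := \prod_(i < n | (i < k)%N) v i *
    \prod_(i < n | (k < i)%N) \int[P]_w \1_(A i) (Y i w).
  have mS : measurable_fun setT S.
    rewrite (_ : S = fun w => \sum_(i < n) if (i < k)%N then b i * Y i w else 0).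
      2: by apply/funext => w; rewrite /S big_mkcond.
    apply: measurable_sum => i; case: (i < k)%N; last exact: measurable_cst.
    exact: measurable_funM.
  have mw (u : R) : measurable_fun setT (fun w => cos (S w + u) * Q w).
    apply: measurable_funM; last exact: mprod.
    by apply: mcos; exact: measurable_funD.
  have w1 (u : R) w : `|cos (S w + u) * Q w| <= 1.
    by apply: normrM_le1; [exact: normr_cos_le1|exact: prod01].
  have wE (u : R) (f : R -> R) : measurable_fun setT f -> (forall y, `|f y| <= 1) ->
      \int[P]_w (cos (S w + u) * Q w * f (Y o w)) = cos u * c * \int[P]_w f (Y o w).
    move=> mf f1; apply: (expectation_weighted (mw u) (w1 u) (mY o) _ mf f1) => D mD.
    (* Because the induction hypothesis holds for all families of sets, it may be used with an
       arbitrary [D] in position [k]. It then says precisely that the weight [cos (S w + u) * Q w]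
       meets the hypothesis of [expectation_weighted] for [Y o]. *)
    pose A' (i : 'I_n) : set R := if i == o then D else A i.
    have A'o : A' o = D by rewrite /A' eqxx.
    have A'i (i : 'I_n) : (k < i)%N -> A' i = A i.
      by rewrite -eqp /A' => /andP[_ /negbTE ->].
    have mA' (i : 'I_n) : measurable (A' i) by rewrite /A'; case: eqP.
    have IHe := IH (ltnW kn) u A' mA'.
    rewrite [X in _ = _ * X](bigD1 o (leqnn k)) A'o in IHe.
    transitivity (\int[P]_w (cos (S w + u) *
        \prod_(i < n | (k <= i)%N) \1_(A' i) (Y i w))).
      apply: eq_Rintegral => w _; rewrite [X in _ = _ * X](bigD1 o (leqnn k)) A'o.
      rewrite -mulrA; congr (_ * _); rewrite [LHS]mulrC; congr (_ * _).
      rewrite /Q; apply: eq_big => i; first by rewrite eqp.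
      by move=> ki; rewrite A'i.
    rewrite IHe /c -!mulrA; congr (_ * _); congr (_ * _).
    rewrite [LHS]mulrC; congr (_ * _); apply: eq_big => i; first by rewrite eqp.
    by rewrite eqp => ki; apply: eq_Rintegral => w _; rewrite A'i.
  have mcb : measurable_fun setT (fun y : R => cos (b o * y)).
    apply: measurableT_comp; first exact: continuous_measurable_fun (@continuous_cos R).
    exact: measurable_funM.
  have msb : measurable_fun setT (fun y : R => sin (b o * y)).
    apply: measurableT_comp; first exact: continuous_measurable_fun (@continuous_sin R).
    exact: measurable_funM.
  have cb1 (y : R) : `|cos (b o * y)| <= 1 by exact: normr_cos_le1.
  have sb1 (y : R) : `|sin (b o * y)| <= 1 by exact: normr_sin_le1.
  have Ecos : \int[P]_w cos (b o * Y o w) = v o.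
    by have := Yv o 0; rewrite cos0 mul1r => <-; apply: eq_Rintegral => w _; rewrite addr0.
  have Esin : \int[P]_w sin (b o * Y o w) = 0.
    (* A phase of [- pi / 2] turns the cosine into a sine and makes the factor [cos e] vanish. *)
    have := Yv o (- (pi / 2)); rewrite cosN cos_pihalf mul0r => <-.
    apply: eq_Rintegral => w _.
    by rewrite cosD cosN sinN cos_pihalf sin_pihalf; ring.
  (* Addition formula, with [sin (S w + e)] written as a cosine of shifted phase so that [wE]
     applies to both terms. *)
  transitivity (\int[P]_w (cos (S w + e) * Q w * cos (b o * Y o w) -
      cos (S w + (e - pi / 2)) * Q w * sin (b o * Y o w))).
    apply: eq_Rintegral => w _; rewrite (bigD1 o) ?ltnSn//=.
    under eq_bigl do rewrite eqs.
    rewrite -/(S w) -/(Q w) -(addrA (b o * _)) [b o * _ + _]addrC cosD.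
    rewrite (_ : sin (S w + e) = cos (S w + (e - pi / 2))); first by ring.
    by rewrite addrA [in RHS]cosD cosN sinN cos_pihalf sin_pihalf; ring.
  rewrite RintegralB//; last 2 first.
  - apply: (@integrable_bounded _ _ _ P 1).
      by apply: measurable_funM => //; apply: measurableT_comp mcb _.
    by move=> w; apply: normrM_le1.
  - apply: (@integrable_bounded _ _ _ P 1).
      by apply: measurable_funM => //; apply: measurableT_comp msb _.
    by move=> w; apply: normrM_le1.
  rewrite (wE e (fun y => cos (b o * y)))// (wE _ (fun y => sin (b o * y)))//.
  rewrite Ecos Esin mulr0 subr0 /c [in RHS](bigD1 o) ?ltnSn//=.
  under [in RHS]eq_bigl do rewrite eqs.
  by ring.
have := key n (leqnn n) e (fun=> setT) (fun=> measurableT).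
rewrite (eq_bigl predT) => [|i]; last by rewrite ltn_ord.
rewrite [X in _ = _ * X]big_pred0 => [|i]; last by rewrite leqNgt ltn_ord.
rewrite mulr1 => <-; apply: eq_Rintegral => w _.
rewrite [X in _ = _ * X]big_pred0 => [|i]; last by rewrite leqNgt ltn_ord.
by rewrite mulr1; congr (cos (_ + _)); apply: eq_bigl => i; rewrite ltn_ord.
Qed.

(** * Brownian motion *)

(** Abel summation. It is used with [h] the values of [W] along the times and with [h] the
    indicators of []0, t i]]; the increments get the same coefficients in both cases, which gives
    the isometry. *)
Lemma sum_by_parts (R : realType) (n : nat) (b h : nat -> R) :
  \sum_(j < n) b j * (h j.+1 - h 0%N) =
  \sum_(i < n) (\sum_(j < n | (i <= j)%N) b j) * (h i.+1 - h i).
Proof.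
under [RHS]eq_bigr do rewrite big_distrl/=.
rewrite (exchange_big_dep predT)//=; apply: eq_bigr => j _.
rewrite -big_distrr/=; congr (_ * _).
rewrite -(telescope_sumr h (leq0n j.+1)) big_mkord.
rewrite (big_ord_widen_cond _ predT (fun i => h i.+1 - h i) (ltn_ord j)).
by apply: eq_bigl => i; rewrite ltnS.
Qed.

Lemma indic_itv_oc_sub (R : realType) (a b c x : R) : a <= b -> b <= c ->
  (\1_(`]a, c]%classic) x : R) - \1_(`]a, b]%classic) x =
  \1_(`]b, c]%classic) x.
Proof.
move=> ab bc; rewrite !indicE !mem_setE !in_itv/=.
have [xb|bx] := leP x b.
  by rewrite (le_trans xb bc) !andbT subrr.
by rewrite (le_lt_trans ab bx) andbF /= subr0.
Qed.

(** The intervals are disjoint, so cross terms vanish and the square of the sum is the sum of the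
    squares. The right side is the variance of the same combination of Brownian increments. *)
Lemma Rintegral_sqr_increments (R : realType) (n : nat) (B t : nat -> R) :
  0 <= t 0%N -> {homo t : i j / (i <= j)%N >-> i <= j} ->
  \int[lebesgue_measure]_(x in `[0, +oo[)
    (\sum_(i < n) B i * \1_(`]t i, t i.+1]%classic) x) ^+ 2 =
  \sum_(i < n) B i ^+ 2 * (t i.+1 - t i).
Proof.
move=> t0 ht.
pose D : set R := `[0, +oo[%classic.
have mD : measurable D by exact: measurable_itv.
pose I i : set R := `]t i, t i.+1]%classic.
have sqE x : (\sum_(i < n) B i * \1_(I i) x) ^+ 2 =
    \sum_(i < n) B i ^+ 2 * \1_(I i) x.
  rewrite expr2 big_distrl/=; apply: eq_bigr => i _.
  rewrite big_distrr/= (bigD1 i)//= big1 ?addr0; last first.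
    move=> j ji.
    suff : (\1_(I i) x : R) * \1_(I j) x = 0 by move=> h; rewrite mulrACA h mulr0.
    rewrite !indicE !mem_setE !in_itv/=.
    have [ij|ij|/val_inj ij] := ltngtP i j; last by rewrite ij eqxx in ji.
      have [xi|xi] := leP x (t i.+1); last by rewrite andbF mul0r.
      by rewrite [(t j < x)%R]ltNge (le_trans xi (ht _ _ ij))/= mulr0.
    have [xj|xj] := leP x (t j.+1); last by rewrite andbF mulr0.
    by rewrite [(t i < x)%R]ltNge (le_trans xj (ht _ _ ij))/= mul0r.
  rewrite mulrACA -expr2; congr (_ * _); rewrite indicE.
  by case: (_ \in _); rewrite ?mulr1 ?mulr0.
have tge0 i : 0 <= t i by rewrite (le_trans t0)// ht.
have ID i : I i `<=` D.
  move=> x; rewrite /I /D /= !in_itv/= andbT => /andP[/ltW + _].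
  exact: le_trans (tge0 i).
have mI i : measurable (I i) by exact: measurable_itv.
have intI i : (\int[lebesgue_measure]_(x in D) (\1_(I i) x)%:E)%E = (t i.+1 - t i)%:E.
  rewrite integral_indic//; last exact: mI.
  rewrite setIidl; last exact: ID.
  apply: etrans (lebesgue_measure_itv _) _; rewrite /= lte_fin -EFinB.
  by case: ltP => // ti; rewrite (@le_anti _ R (t i.+1) (t i)) ?subrr// ti ht.
have iI i : lebesgue_measure.-integrable D (EFin \o (fun x => B i ^+ 2 * \1_(I i) x)).
  rewrite /comp; under eq_fun do rewrite EFinM.
  apply: integrableZl => //.
  apply/integrableP; split; first by apply/measurable_EFinP; apply: measurable_indic; exact: mI.
  under eq_integral do rewrite /= ger0_norm//.
  by rewrite intI ltry.
under eq_Rintegral do rewrite sqE.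
have [//|i|_ ->] := @Rintegral_sum _ _ R lebesgue_measure D _ (index_enum 'I_n)
  (fun i x => B i ^+ 2 * \1_(I i) x).
  exact: iI.
apply: eq_bigr => i _.
rewrite /Rintegral; under eq_integral do rewrite EFinM.
rewrite ge0_integralZl//.
- by rewrite intI.
- by apply/measurable_EFinP; apply: measurable_indic; exact: mI.
- by rewrite lee_fin sqr_ge0.
Qed.

(** [W u] corresponds to the indicator of []0, u]]. Stating the variance as a squared L^2 norm makes
    it independent of any partition, so lists with unordered or repeated times are allowed and
    limits can be taken. *)
Lemma Rintegral_cos_brownian d (T : measurableType d) (R : realType)
    (P : probability T R) (W : R -> {RV P >-> R}) (s : seq (R * R)) (e : R) :
  brownian_motion W -> (forall p, p \in s -> 0 <= p.2) ->
  \int[P]_w cos (\sum_(p <- s) p.1 * W p.2 w + e) =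
  cos e * expR (- ((\int[lebesgue_measure]_(x in `[0, +oo[)
     (\sum_(p <- s) p.1 * \1_(`]0, p.2]%classic) x) ^+ 2) / 2)).
Proof.
move=> [W0 indW nW _] s0.
pose leT (p q : R * R) := p.2 <= q.2.
(* Independence of increments is available only along ordered times; both sides are invariant under
   permutation of the list. *)
pose s' := sort leT s.
have ss' : perm_eq s s' by rewrite perm_sym perm_sort.
under eq_Rintegral do rewrite (perm_big _ ss').
under [in RHS]eq_Rintegral do rewrite (perm_big _ ss').
have {}s0 p : p \in s' -> 0 <= p.2 by rewrite -(perm_mem ss'); exact: s0.
have sorted_s' : sorted leT s'.
  by apply: sort_sorted => p q; exact: le_total.
move: s' sorted_s' s0 {ss'} => {}s sorted_s s0.
pose n := size s.
(* [brownian_motion] expects an infinite nondecreasing sequence: time 0 is put in front, and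
   truncating the index at [n] makes the sequence stationary after the last time. *)
pose t i := nth 0 (0 :: map snd s) (minn i n).
have st : sorted (@Order.le _ R) (0 :: map snd s).
  rewrite /= path_sortedE; last exact: le_trans.
  rewrite sorted_map sorted_s andbT.
  by apply/allP => _ /mapP[p ps ->]; exact: s0.
have ht : {homo t : i j / (i <= j)%N >-> i <= j}.
  move=> i j ij; rewrite /t.
  have := sorted_leq_nth le_trans lexx 0 st; apply.
  - by rewrite inE /= size_map ltnS geq_minr.
  - by rewrite inE /= size_map ltnS geq_minr.
  - by rewrite leq_min geq_minr andbT geq_min ij.
have t0 : t 0%N = 0 by rewrite /t min0n.
have tS (i : 'I_n) : t i.+1 = (nth (0, 0) s i).2.
  by rewrite /t (minn_idPl (ltn_ord i)) /= (nth_map (0, 0)).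
have tge0 i : 0 <= t i by rewrite -t0 ht.
pose b i := (nth (0, 0) s i).1.
have bigE (F : R -> R) : \sum_(p <- s) p.1 * F p.2 = \sum_(j < n) b j * F (t j.+1).
  rewrite (big_nth (0, 0)) big_mkord; apply: eq_bigr => j _.
  by rewrite tS.
pose B i := \sum_(j < n | (i <= j)%N) b j.
(* [W 0] vanishes only almost surely, so the integrands agree only almost everywhere. *)
transitivity (\int[P]_w cos (\sum_(i < n) B i * (W (t i.+1) w - W (t i) w) + e)).
  rewrite /Rintegral; congr fine; apply: ae_eq_integral => //.
  - apply/measurable_EFinP; apply: measurableT_comp.
      exact: continuous_measurable_fun (@continuous_cos R).
    apply: measurable_funD => //; apply: measurable_sum => p.
    exact: measurable_funM.
  - apply/measurable_EFinP; apply: measurableT_comp.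
      exact: continuous_measurable_fun (@continuous_cos R).
    apply: measurable_funD => //; apply: measurable_sum => i.
    by apply: measurable_funM => //; exact: measurable_funB.
  - apply: filterS W0 => w W0w _; congr (cos (_ + _))%:E.
    rewrite -(sum_by_parts n b (fun i => W (t i) w)) (bigE (fun u => W u w)).
    by apply: eq_bigr => j _; rewrite t0 W0w subr0.
rewrite (@Rintegral_cos_independent _ _ _ P n (fun i w => W (t i.+1) w - W (t i) w)
  (fun i => B i) (fun i => expR (- (B i ^+ 2 * (t i.+1 - t i) / 2)))).
- congr (_ * _); rewrite -(big_morph expR (@expRD R) (@expR0 R)); congr expR.
  rewrite sumrN -mulr_suml; congr (- (_ / 2)).
  rewrite -(@Rintegral_sqr_increments R n B t) ?t0//.
  apply: eq_Rintegral => x _; congr (_ ^+ 2).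
  rewrite (bigE (fun u => \1_(`]0, u]%classic) x)).
  transitivity (\sum_(j < n) b j * ((\1_(`]0, t j.+1]%classic) x : R) -
      \1_(`]0, t 0%N]%classic) x)).
    rewrite (sum_by_parts n b (fun i => \1_(`]0, t i]%classic) x)).
    by apply: eq_bigr => i _; rewrite indic_itv_oc_sub// ht.
  by apply: eq_bigr => j _; rewrite t0 set_itvoc0 indic0 subr0.
- by move=> i; exact: measurable_funB.
- by apply: indW => //; rewrite t0.
- move=> i u; have := Rintegral_cos_is_normal _ (nW (t i) (t i.+1) _) (B i) u.
  rewrite mulr0 add0r sqr_sqrtr ?subr_ge0 ?ht// => ->.
  + by congr (_ * expR (- (_ / 2))); rewrite mulrC.
  + exact: measurable_funB.
  + by rewrite tge0.
Qed.

(** * The covariance of the Wiener integral *)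

Section power_integrals.
Context {R : realType}.
Let mu := @lebesgue_measure R.
Local Open Scope ereal_scope.

(** Lebesgue measure equals [u] times its image under multiplication by [u], by uniqueness on
    half-open intervals; the rest is integration against a pushforward. *)
Lemma ge0_integral_scale (u : R) (f : R -> R) : (0 < u)%R ->
  measurable_fun setT f -> (forall x, 0 <= f x)%R ->
  \int[mu]_(x in `]0%R, +oo[) (f x)%:E =
  u%:E * \int[mu]_(x in `]0%R, +oo[) (f (u * x)%R)%:E.
Proof.
move=> u0 mf f0.
pose phi : measurableTypeR R -> measurableTypeR R := fun x => (u * x)%R.
have mphi : measurable_fun setT phi by exact: measurable_funM.
pose pm : {measure set (measurableTypeR R) -> \bar R} :=
  measure_function_pushforward__canonical__measure_function_Measure mu mphi.
pose m : {measure set (measurableTypeR R) -> \bar R} :=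
  mscale (NngNum (ltW u0)) pm.
have mE A : measurable A -> mu A = m A.
  apply: lebesgue_measure_unique => _ [[a b]] _ <-.
  transitivity (u%:E * mu (phi @^-1` `]a, b])); last by [].
  have -> : phi @^-1` `]a, b] = `](a / u)%R, (b / u)%R]%classic.
    apply/seteqP; split => x /=; rewrite !in_itv/= /phi.
      by rewrite ltr_pdivrMr// ler_pdivlMr// mulrC.
    by rewrite ltr_pdivrMr// ler_pdivlMr// mulrC.
  rewrite /mu !lebesgue_measure_itv/= !lte_fin ltr_pM2r ?invr_gt0//.
  case: ifP => _; last by rewrite mule0.
  by rewrite -!EFinB -EFinM -mulrBl mulrC divfK// gt_eqF.
transitivity (\int[m]_(x in `]0%R, +oo[) (f x)%:E).
  by apply: eq_measure_integral => A mA _; exact: mE.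
rewrite ge0_integral_mscale//=; last 2 first.
- by apply/measurable_EFinP; exact: measurable_funTS.
- by move=> x _; rewrite lee_fin.
congr (_ * _); rewrite ge0_integral_pushforward//=.
- have -> : phi @^-1` `]0%R, +oo[ = `]0%R, +oo[%classic; last by [].
  apply/seteqP; split => x /=; rewrite !in_itv/= !andbT /phi; first by rewrite pmulr_rgt0.
  by move=> x0; rewrite mulr_gt0.
- by apply/measurable_EFinP; exact: measurable_funTS.
- by move=> x _; rewrite lee_fin.
Qed.

Lemma integral_powR_itv0c (K t : R) : (0 < K)%R -> (0 < t)%R ->
  \int[mu]_(x in `]0%R, t]) (x `^ (K - 1))%:E = (t `^ K / K)%:E.
Proof.
move=> K0 t0.
(* For [K < 1] the integrand is unbounded at 0. The fundamental theorem of calculus is applied on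
   [[x_ n, t]], and these sets increase to []0, t]]; the factor 1/2 keeps [x_ 0 < t]. *)
pose x_ n : R := (t / 2 * harmonic n)%R.
have x0 n : (0 < x_ n)%R by apply: mulr_gt0; [exact: divr_gt0|rewrite /harmonic /= invr_gt0].
have xt n : (x_ n < t)%R.
  apply: (@le_lt_trans _ _ (t / 2)%R).
    rewrite ler_piMr//; first by apply/ltW; exact: divr_gt0.
    by rewrite /harmonic /= invf_le1// ler1n.
  by rewrite ltr_pdivrMr// ltr_pMr// ltr1n.
have xcvg : x_ n @[n --> \oo] --> (0 : R)%R.
  rewrite -(mulr0 (t / 2)%R); apply: cvgM; first exact: cvg_cst.
  exact: cvg_harmonic.
pose F n : set (measurableTypeR R) := `[x_ n, t]%classic.
have bigF : \bigcup_n F n = `]0%R, t]%classic.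
  apply/seteqP; split => x /=.
    move=> [n _]; rewrite /F /= !in_itv/= => /andP[xx ->].
    by rewrite (lt_le_trans (x0 n) xx).
  rewrite in_itv/= => /andP[xp xt'].
  move/cvgrPdist_lt : xcvg => /(_ _ xp)[n _ hn].
  exists n => //; rewrite /F /= in_itv/= xt' andbT.
  by have := hn n (leqnn n); rewrite sub0r normrN gtr0_norm// => /ltW.
have ndF : {homo F : n m / (n <= m)%N >-> (n <= m)%O}.
  move=> n m nm; apply/subsetPset => x; rewrite /F /= !in_itv/= => /andP[xx ->].
  rewrite andbT (le_trans _ xx)// /x_ ler_pM2l ?divr_gt0//.
  by rewrite /harmonic /= lef_pV2 ?posrE// ler_nat.
have := @ge0_nondecreasing_set_cvg_integral _ (measurableTypeR R) R F
  (fun x : measurableTypeR R => ((x : R) `^ (K - 1))%:E) lebesgue_measure ndF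
   _ _ _.
rewrite bigF => cv.
have {}cv : \int[mu]_(x in F i) (x `^ (K - 1))%:E @[i --> \oo] -->
    \int[mu]_(x in `]0%R, t]) (x `^ (K - 1))%:E.
  apply: cv => [i|i|i x _].
  - exact: measurable_itv.
  - by apply/measurable_EFinP; apply: measurable_funTS; exact: measurable_powR.
  - by rewrite lee_fin powR_ge0.
rewrite -(cvg_lim _ cv)//; apply/cvg_lim => //.
have dF (x : R) : (0 < x)%R -> is_derive x (1 : R)%R (fun x => x `^ K / K)%R (x `^ (K - 1))%R.
  move=> xp; have ? := is_derive1_powR K xp.
  apply: is_derive_eq; rewrite /GRing.scale/= mulr0 add0r.
  by rewrite mulKf// gt_eqF.
have cpow (a x : R) : (0 < x)%R -> {for x, continuous (fun y => y `^ a)%R}.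
  move=> xp; apply: differentiable_continuous; apply/derivable1_diffP.
  by have [] := is_derive1_powR a xp.
have intE n : \int[mu]_(x in F n) (x `^ (K - 1))%:E = (t `^ K / K - x_ n `^ K / K)%:E.
  rewrite (@continuous_FTC2 _ _ (fun x => x `^ K / K)%R)//.
  - apply: continuous_in_subspaceT => x; rewrite inE /= in_itv/= => /andP[xx _].
    by apply: cpow; rewrite (lt_le_trans _ xx).
  - split => [x||].
    + rewrite in_itv/= => /andP[xx _].
      by have [] := dF x (lt_trans (x0 n) xx).
    + apply: cvg_at_right_filter; apply: cvgM; last exact: cvg_cst.
      exact: cpow.
    + apply: cvg_at_left_filter; apply: cvgM; last exact: cvg_cst.
      exact: cpow.
  - move=> x; rewrite in_itv/= => /andP[xx _].
    by rewrite derive1E; have [_ ->] := dF x (lt_trans (x0 n) xx).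
rewrite (_ : (fun i => _) = (fun n => (t `^ K / K - x_ n `^ K / K)%:E)); last exact/funext.
apply: cvg_EFin; first exact: nearW.
rewrite -[X in _ --> X]subr0; apply: (@cvgB _ R^o); first exact: cvg_cst.
rewrite -(mul0r K^-1%R); apply: cvgM; last exact: cvg_cst.
have := @powR_cvg0 R K K0; move/cvg_at_rightP; apply.
by split.
Qed.

End power_integrals.

(** * The Gamma function and the integral of the kernel *)

Section gamma_function.
Context {R : realType}.
Let mu := @lebesgue_measure R.

Lemma measurable_gamma_fun (a : R) :
  measurable_fun [set: R] (fun x : R => x `^ a * expR (- x)).
Proof.
apply: measurable_funM; first exact: measurable_powR.
by apply: measurableT_comp => //; exact: measurable_oppr.
Qed.

(** On []0, 1]] the exponential is at most 1; beyond 1 the power is at most 1 because [a <= 1]. The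
    second majorant is the density of the exponential law of rate 1. *)
Lemma integrable_gamma_fun (a : R) : 0 < a -> a <= 1 ->
  mu.-integrable `]0, +oo[ (fun x => (x `^ (a - 1) * expR (- x))%:E).
Proof.
move=> a0 a1.
have i1 : mu.-integrable `]0, +oo[ (fun x => (x `^ (a - 1) * \1_(`]0, 1]%classic) x)%:E).
  apply/integrableP; split.
    apply/measurable_EFinP/measurable_funTS/measurable_funM.
      exact: measurable_powR.
    by apply: measurable_indic.
  under eq_integral => x _ do rewrite abse_EFin ger0_norm ?mulr_ge0 ?powR_ge0//.
  rewrite (_ : (\int[_]_(x in _) _)%E = (\int[mu]_(x in `]0%R, 1%R]) (x `^ (a - 1))%:E)%E).
    by rewrite integral_powR_itv0c// ltry.
  rewrite [RHS]integral_mkcond [LHS]integral_mkcond; apply: eq_integral => x _.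
  rewrite !patchE indicE !mem_setE !in_itv/= andbT.
  by case: (0 < x) => //=; case: (x <= 1); rewrite ?mulr1 ?mulr0.
have i2 : mu.-integrable `]0, +oo[ (fun x => (expR (- x))%:E).
  have h : mu.-integrable `]0, +oo[ (EFin \o exponential_pdf 1).
    apply: (@integrableS _ _ _ mu setT) => //.
    exact: integrable_exponential_pdf.
  move: h; apply: eq_integrable => //= x; rewrite inE /= in_itv/= andbT => x0.
  by rewrite exponential_pdfE ?ltW// mul1r mulN1r.
have i12 : mu.-integrable `]0, +oo[
    (fun x => (x `^ (a - 1) * \1_(`]0, 1]%classic) x + expR (- x))%:E).
  by apply: (integrableD _ i1 i2).
apply: (@le_integrable _ _ R mu _ _ _ _ _ _ i12) => //.
  by apply/measurable_EFinP/measurable_funTS; exact: measurable_gamma_fun.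
move=> x; rewrite /= in_itv/= andbT => x0.
rewrite lee_fin !ger0_norm ?mulr_ge0 ?addr_ge0 ?mulr_ge0 ?expR_ge0 ?powR_ge0//.
rewrite indicE mem_setE in_itv/= x0/=.
have [x1|x1] := leP x 1.
  rewrite mulr1 -[leLHS]addr0 lerD ?expR_ge0// ler_piMr ?powR_ge0//.
  by rewrite -expR0 ler_expR oppr_le0 ltW.
rewrite mulr0 add0r ler_piMl ?expR_ge0//.
by rewrite -[leRHS](powRr0 x); apply: ler_powR; [exact: ltW|rewrite subr_le0].
Qed.

(** [Gamma] is a real-valued integral, which would read 0 if the extended integral were infinite.
    Integrability excludes this and gives access to Tonelli and to scaling. *)
Lemma EFin_Gamma (a : R) : 0 < a -> a <= 1 ->
  (Gamma a)%:E = (\int[mu]_(x in `]0%R, +oo[) (x `^ (a - 1) * expR (- x))%:E)%E.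
Proof.
move=> a0 a1; rewrite /Gamma /Rintegral fineK//.
by apply: integrable_fin_num => //; exact: integrable_gamma_fun.
Qed.

Lemma integral_one_minus_exp (K t : R) : 0 < K -> K < 1 -> 0 < t ->
  (\int[mu]_(x in `]0%R, +oo[) ((1 - expR (- x * t)) * x `^ (- 1 - K))%:E)%E =
  (t `^ K * Gamma (1 - K) / K)%:E.
Proof.
move=> K0 K1 t0.
(* Exponent [- K] is [- 1 - K] raised by the factor [x] in [x exp(-x y)]. Indicators carry the
   domains, so that Tonelli is applied on the whole plane. *)
pose f (z : measurableTypeR R * measurableTypeR R) : \bar R :=
  ((\1_(`]0, +oo[%classic) z.1 * \1_(`]0, t]%classic) z.2) *
   (z.1 `^ (- K) * expR (- (z.1 * z.2))))%:E.
have mf : measurable_fun setT f.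
  apply/measurable_EFinP; apply: measurable_funM.
    apply: measurable_funM.
      by apply: measurableT_comp; [exact: measurable_indic|exact: measurable_fst].
    by apply: measurableT_comp; [exact: measurable_indic|exact: measurable_snd].
  apply: measurable_funM.
    exact: (measurableT_comp (measurable_powR (- K)) measurable_fst).
  apply: measurableT_comp => //; apply: measurableT_comp => //.
  by apply: measurable_funM; [exact: measurable_fst|exact: measurable_snd].
have f0 z : (0 <= f z)%E by rewrite lee_fin !mulr_ge0 ?powR_ge0 ?expR_ge0.
have := @fubini_tonelli _ _ _ _ _ mu mu f mf f0.
have inner1 x : 0 < x -> (\int[mu]_y f (x, y) = ((1 - expR (- x * t)) * x `^ (- 1 - K))%:E)%E.
  move=> x0.
  transitivity (\int[mu]_(y in `]0%R, t]) (x `^ (- K) * expR (- (x * y)))%:E)%E.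
    rewrite [RHS]integral_mkcond; apply: eq_integral => y _.
    rewrite /f /= patchE !indicE !mem_setE !in_itv/= x0 /= mul1r.
    by case: ifPn => _; rewrite ?mul1r ?mul0r.
  have cF : continuous (fun y : R => x `^ (- K) * expR (- (x * y))).
    move=> y; apply: cvgM; first exact: cvg_cst.
    apply: (@continuous_comp _ _ _ (fun y => - (x * y)) expR).
      by apply: (@cvgN _ R^o); apply: cvgM; [exact: cvg_cst|exact: cvg_id].
    exact: continuous_expR.
  have dF (y : R) : is_derive y (1 : R) (fun y => - x `^ (- K) / x * expR (- (x * y)))
      (x `^ (- K) * expR (- (x * y))).
    apply: is_derive_eq; rewrite /GRing.scale/= /GRing.scale/=; field.
    by rewrite gt_eqF.
  have cF' : continuous (fun y => - x `^ (- K) / x * expR (- (x * y))).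
    by move=> y; apply: differentiable_continuous; apply/derivable1_diffP.
  rewrite integral_itv_obnd_cbnd; last first.
    by apply/measurable_EFinP/measurable_funTS; exact: continuous_measurable_fun.
  rewrite (@continuous_FTC2 _ _ (fun y => - x `^ (- K) / x * expR (- (x * y))))//.
  - rewrite mulr0 oppr0 expR0 -EFinB; congr EFin.
    rewrite (addrC (- 1) (- K)) powRD; last by rewrite (gt_eqF x0) implybT.
    by rewrite powR_inv1 ?ltW// [- x * t]mulNr; ring.
  - by apply: continuous_subspaceT => y; exact: cF.
  - split => [y _||].
    + by have [] := dF y.
    + by apply: cvg_at_right_filter; exact: cF'.
    + by apply: cvg_at_left_filter; exact: cF'.
  - by move=> y _; rewrite derive1E; have [_ ->] := dF y.
have KG : 1 - K - 1 = - K by ring.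
have K10 : 0 < 1 - K by rewrite subr_gt0.
have K11 : 1 - K <= 1 by rewrite gerBl ltW.
(* For [y] in []0, t]], rescaling [x] by [y] gives [Gamma (1 - K)] times [y ^ (K - 1)]; outside, the
   integrand is 0. *)
have inner2 y : (\int[mu]_x f (x, y) =
    (Gamma (1 - K) * (y `^ (K - 1) * \1_(`]0, t]%classic) y))%:E)%E.
  have [/[!inE]/[dup] yt|yt] := boolP (y \in `]0, t]%classic); last first.
    rewrite indicE (negbTE yt) !mulr0; apply: integral0_eq => x _.
    by rewrite /f /= !indicE (negbTE yt) mulr0 mul0r.
  rewrite /= in_itv/= => /andP[y0 ylet].
  rewrite indicE mem_set// mulr1.
  have := @ge0_integral_scale R y _ y0 (measurable_gamma_fun (- K))
    (fun x => mulr_ge0 (powR_ge0 _ _) (expR_ge0 _)).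
  rewrite -[in LHS]KG -EFin_Gamma// => scE.
  have {}scE : (Gamma (1 - K))%:E = ((y * y `^ (- K))%:E * \int[mu]_x f (x, y))%E.
    rewrite scE EFinM -muleA; congr (_ * _)%E.
    rewrite -ge0_integralZl//; last 2 first.
    - exact: (measurableT_comp mf (pair2_measurable y)).
    - by rewrite lee_fin powR_ge0.
    rewrite [LHS]integral_mkcond; apply: eq_integral => x _.
    rewrite patchE /f /= !indicE !mem_setE !in_itv/= andbT y0 ylet mulr1.
    case: ifPn => x0; last by rewrite mul0r mule0.
    by rewrite mul1r -EFinM mulrA powRM ?ltW// [x * y]mulrC.
  have yK : y * y `^ (- K) = (y `^ (K - 1))^-1.
    rewrite -powRN opprB powRD ?(gt_eqF y0) ?implybT// powRr1 1?ltW//.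
  have yK0 : y `^ (K - 1) != 0 by rewrite gt_eqF// powR_gt0.
  rewrite EFinM scE yK muleC muleA -EFinM divff// mul1e//.
move=> fub.
transitivity (\int[mu]_x \int[mu]_y f (x, y))%E.
  rewrite [LHS]integral_mkcond; apply: eq_integral => x _.
  rewrite patchE mem_setE in_itv/= andbT; case: ifPn => x0.
    by rewrite inner1.
  symmetry; apply: integral0_eq => y _.
  by rewrite /f /= !indicE mem_setE in_itv/= andbT (negbTE x0) !mul0r.
rewrite fub.
have G0 : (0 <= (Gamma (1 - K))%:E)%E.
  rewrite (EFin_Gamma K10 K11).
  by apply: integral_ge0 => x _; rewrite lee_fin mulr_ge0 ?powR_ge0 ?expR_ge0.
move: (Gamma (1 - K)) inner2 G0 => G inner2 G0.
pose h (y : measurableTypeR R) : \bar R := (y `^ (K - 1) * \1_(`]0, t]%classic) y)%:E.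
have mh : measurable_fun setT h.
  apply/measurable_EFinP/measurable_funM; first exact: measurable_powR.
  exact: measurable_indic.
have h0 y : [set: measurableTypeR R] y -> (0 <= h y)%E.
  by move=> _; rewrite lee_fin mulr_ge0 ?powR_ge0.
transitivity (\int[mu]_y (G%:E * h y))%E.
  by apply: eq_integral => y _; rewrite inner2 EFinM.
rewrite (ge0_integralZl mu measurableT mh h0 G0).
have -> : (\int[mu]_x h x = (t `^ K / K)%:E)%E.
  rewrite -(integral_powR_itv0c K0 t0) [RHS]integral_mkcond; apply: eq_integral => x _.
  by rewrite /h patchE indicE; case: ifPn => xt; rewrite ?mulr1 ?mulr0.
by rewrite -EFinM mulrCA mulrA.
Qed.

(** On []0, 1]] the integrand is at least [exp(-1) x^(a - 1)], whose integral is [exp(-1) / a].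
    Positivity is needed for the square root and the division in [C1]. *)
Lemma Gamma_gt0 (a : R) : 0 < a -> a <= 1 -> 0 < Gamma a.
Proof.
move=> a0 a1; rewrite -lte_fin (EFin_Gamma a0 a1).
have mg (D : set R) : measurable_fun D (fun x => (x `^ (a - 1) * expR (- x))%:E).
  by apply/measurable_EFinP/measurable_funTS; exact: measurable_gamma_fun.
apply: (@lt_le_trans _ _ (\int[mu]_(x in `]0%R, 1%R]) ((expR (- 1))%:E * (x `^ (a - 1))%:E))%E).
  rewrite ge0_integralZl//.
  - rewrite integral_powR_itv0c// -EFinM lte_fin.
    by rewrite mulr_gt0 ?expR_gt0// divr_gt0// powR_gt0.
  - by apply/measurable_EFinP/measurable_funTS; exact: measurable_powR.
  - by move=> x _; rewrite lee_fin powR_ge0.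
apply: (@le_trans _ _ (\int[mu]_(x in `]0%R, 1%R]) (x `^ (a - 1) * expR (- x))%:E)%E).
  apply: ge0_le_integral => //.
  - by move=> x _; rewrite -EFinM lee_fin mulr_ge0 ?powR_ge0 ?expR_ge0.
  - apply: emeasurable_funM => //.
    by apply/measurable_EFinP/measurable_funTS; exact: measurable_powR.
  - exact: mg.
  - move=> x; rewrite /= in_itv/= => /andP[_ x1].
    by rewrite -EFinM lee_fin mulrC ler_wpM2l ?powR_ge0// ler_expR lerN2.
apply: ge0_subset_integral => //.
- exact: mg.
- by move=> x _; rewrite lee_fin mulr_ge0 ?powR_ge0 ?expR_ge0.
- by move=> x; rewrite /= !in_itv/= andbT => /andP[].
Qed.

End gamma_function.

Lemma Rintegral_kernel_product (R : realType) (K t u : R) : 0 < K -> K < 1 ->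
  0 <= t -> 0 <= u ->
  let k t x : R := (1 - expR (- x * t)) * x `^ (- ((1 + K) / 2)) in
  lebesgue_measure.-integrable `[0, +oo[ (fun x => (k t x * k u x)%:E) /\
  \int[lebesgue_measure]_(x in `[0, +oo[) (k t x * k u x) =
  Gamma (1 - K) / K * (t `^ K + u `^ K - (t + u) `^ K).
Proof.
move=> K0 K1 t0 u0 k.
pose mu := @lebesgue_measure R.
pose h t x : R := (1 - expR (- x * t)) * x `^ (- 1 - K).
have mexp v : measurable_fun [set: R] (fun x : R => expR (- x * v)).
  apply: measurableT_comp => //; apply: measurable_funM => //.
have mh v : measurable_fun [set: R] (h v).
  apply: measurable_funM; last exact: measurable_powR.
  exact: measurable_funB.
have mk v : measurable_fun [set: R] (k v).
  apply: measurable_funM; last exact: measurable_powR.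
  exact: measurable_funB.
have intE v : 0 <= v ->
    (\int[mu]_(x in `[0%R, +oo[) (h v x)%:E = (Gamma (1 - K) / K * v `^ K)%:E)%E.
  rewrite le_eqVlt => /predU1P[<-|v0].
    rewrite powR0 ?gt_eqF// mulr0; apply: integral0_eq => x _.
    by rewrite /h mulr0 expR0 subrr mul0r.
  rewrite -integral_itv_obnd_cbnd; last first.
    by apply/measurable_EFinP/measurable_funTS; exact: mh.
  by rewrite integral_one_minus_exp//; congr EFin; ring.
have hge0 v x : 0 <= v -> x \in `[0, +oo[%classic -> 0 <= h v x.
  move=> v0; rewrite inE /= in_itv/= andbT => x0.
  by rewrite mulr_ge0 ?powR_ge0// subr_ge0 -expR0 ler_expR mulNr oppr_le0 mulr_ge0.
have inth v : 0 <= v -> mu.-integrable `[0, +oo[ (EFin \o h v).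
  move=> v0; apply/integrableP; split.
    by apply/measurable_EFinP/measurable_funTS; exact: mh.
  under eq_integral => x xD do rewrite /= ger0_norm ?hge0//.
  by rewrite intE// ltry.
have REh v : 0 <= v -> \int[mu]_(x in `[0, +oo[) h v x = Gamma (1 - K) / K * v `^ K.
  by move=> v0; rewrite /Rintegral intE.
have kE x : k t x * k u x = h t x + h u x - h (t + u) x.
  rewrite /k /h mulrACA (_ : x `^ _ * x `^ _ = x `^ (- 1 - K)).
    by rewrite (mulrDr (- x)) expRD; ring.
  (* [powR] sends base 0 to 0 for every nonzero exponent, so the two exponents agree in effect there
     too and the identity holds on all of [[0, +oo[]. *)
  have [->|x0] := eqVneq x 0.
    by rewrite !powR0 ?mul0r//; apply/eqP; lra.
  by rewrite -powRD; [congr (_ `^ _); field|rewrite x0 implybT].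
have iD : mu.-integrable `[0, +oo[ (EFin \o (fun x => h t x + h u x)).
  by apply: (integrableD _ (inth t t0) (inth u u0)).
have itu := inth _ (addr_ge0 t0 u0).
have i3 : mu.-integrable `[0, +oo[ (EFin \o (fun x => h t x + h u x - h (t + u) x)).
  by apply: (integrableB _ iD itu).
split.
  by move: i3; apply: eq_integrable => // x _ /=; rewrite -kE.
under eq_Rintegral do rewrite kE.
rewrite RintegralB// RintegralD ?inth// !REh ?addr_ge0//.
by ring.
Qed.

(** * Trigonometric polynomials determine joint laws *)

Lemma bernoulli_le (R : realDomainType) (x : R) (n : nat) : -1 <= x ->
  1 + x *+ n <= (1 + x) ^+ n.
Proof.
move=> x1; elim: n => [|n IH]; first by rewrite mulr0n addr0 expr0.
have x10 : 0 <= 1 + x by lra.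
rewrite exprS; apply: le_trans (ler_wpM2l x10 IH).
have : 0 <= x * (x *+ n) by rewrite mulrnAr mulrn_wge0// -expr2 sqr_ge0.
by rewrite mulrS; move: (x *+ n) => y; nra.
Qed.

Lemma cvg_natr_expr (R : realType) (q : R) : 0 <= q < 1 ->
  k%:R * q ^+ k @[k --> \oo] --> (0 : R).
Proof.
move=> /andP[q0 q1]; have [->|qN0] := eqVneq q 0.
  apply: (@squeeze_cvg_norm _ _ (cst 0)); last exact: cvg_cst.
  by case=> [|n]; rewrite subr0 ?mul0r ?expr0n ?mulr0 normr0.
have qp : 0 < q by rewrite lt_neqAle eq_sym qN0.
(* Half of the decay pays for the factor [k]: by Bernoulli [k s^k] stays below [1 / h] with
   [h = 1 / s - 1], and the other [s^k] tends to 0. *)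
pose s := Num.sqrt q; have s0 : 0 < s by rewrite sqrtr_gt0.
have s1 : s < 1 by rewrite -(sqrtr1 R) ltr_sqrt.
have sq : q = s ^+ 2 by rewrite sqr_sqrtr.
pose h := s^-1 - 1.
have h0 : 0 < h by rewrite subr_gt0 invf_gt1.
have ks k : k%:R * s ^+ k <= h^-1.
  have hb : 1 + h *+ k <= s^-1 ^+ k.
    have -> : s^-1 = 1 + h by rewrite addrC subrK.
    by apply: bernoulli_le; rewrite (le_trans _ (ltW h0))// lerN10.
  rewrite -ler_pdivlMr ?exprn_gt0// -exprVn ler_pdivlMl// mulr_natr.
  by apply: le_trans hb; rewrite lerDr.
apply: (@squeeze_cvg_norm _ _ (fun k => h^-1 * s ^+ k)).
  move=> k; rewrite subr0 ger0_norm ?mulr_ge0 ?exprn_ge0//.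
  by rewrite sq -exprM mulnC exprM expr2 mulrA ler_wpM2r// exprn_ge0// ltW.
rewrite -(mulr0 h^-1); apply: cvgM; first exact: cvg_cst.
by apply: cvg_expr; rewrite gtr0_norm.
Qed.

(* The factor k in the exponent settles the boundary case p = 1/2. *)
Lemma cvg_poly_step (R : realType) (p : R) : 0 <= p <= 1 ->
  (1 - p ^+ k) ^+ (k * 2 ^ k) @[k --> \oo] --> ((p < 2^-1)%R%:R : R).
Proof.
move=> /andP[p0 p1].
have pk0 k : 0 <= p ^+ k by rewrite exprn_ge0.
have pk1 k : p ^+ k <= 1 by rewrite exprn_ile1.
have mE k : p ^+ k *+ (k * 2 ^ k) = k%:R * (2 * p) ^+ k.
  by rewrite exprMn -mulr_natl natrM natrX mulrA.
have [ph|ph] := ltP p 2^-1.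
  (* Below 1/2, Bernoulli bounds the distance to 1 by [m p^k = k (2 p)^k], where [m = k 2^k]. *)
  apply: (@squeeze_cvg_norm _ _ (fun k => k%:R * (2 * p) ^+ k)).
    move=> k; rewrite distrC ger0_norm; last first.
      by rewrite subr_ge0 exprn_ile1 ?subr_ge0// gerBl.
    rewrite lerBlDr -lerBlDl -mE.
    apply: le_trans (bernoulli_le _ _); last by rewrite lerN2.
    by rewrite mulNrn.
  apply: cvg_natr_expr; rewrite mulr_ge0//=.
  by rewrite mulrC -ltr_pdivlMr// div1r.
apply: (@squeeze_cvg_norm _ _ harmonic); last exact: cvg_harmonic.
move=> k; rewrite subr0 ger0_norm ?exprn_ge0 ?subr_ge0// /harmonic/=.
set m := (k * 2 ^ k)%N.
(* From 1/2 on, the power is at most the inverse of [(1 + p^k)^m], since the product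
   [(1 - p^(2 k))^m] is at most 1; Bernoulli makes that inverse at most [1 / (1 + k)]. *)
have h1 : 1 + k%:R <= (1 + p ^+ k) ^+ m.
  apply: le_trans (bernoulli_le _ _); last by rewrite (le_trans _ (pk0 k))// lerN10.
  rewrite lerD2l mE ler_peMr// exprn_ege1//.
  by rewrite mulrC -ler_pdivrMr// div1r.
have h2 : (1 - p ^+ k) ^+ m * (1 + p ^+ k) ^+ m <= 1.
  rewrite -exprMn -subr_sqr expr1n exprn_ile1// ?subr_ge0 ?gerBl ?sqr_ge0//.
  by rewrite exprn_ile1.
rewrite -[leRHS]div1r ler_pdivlMr//; apply: le_trans h2.
rewrite ler_wpM2l ?exprn_ge0 ?subr_ge0//.
by rewrite -natr1 addrC.
Qed.

Section trigonometric_polynomials.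
Variables (R : realType) (n : nat).

Inductive trigpoly : (('I_n -> R) -> R) -> Prop :=
| trigpoly_cos (a : 'I_n -> R) (e : R) :
    trigpoly (fun x => cos (\sum_(i < n) a i * x i + e))
| trigpolyD f g : trigpoly f -> trigpoly g -> trigpoly (fun x => f x + g x)
| trigpolyZ (c : R) f : trigpoly f -> trigpoly (fun x => c * f x).

(** The product-to-sum formula for two cosines, extended by bilinearity through inductions on both
    factors. *)
Lemma trigpolyM f g : trigpoly f -> trigpoly g -> trigpoly (fun x => f x * g x).
Proof.
move=> tf; elim: tf g => {f} [a e g|f f' _ IHf _ IHf' g tg|c f _ IHf g tg].
- elim=> {g} [b u|g g' _ IHg _ IHg'|c g _ IHg].
  + pose A (x : 'I_n -> R) := \sum_(i < n) (a i + b i) * x i + (e + u).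
    pose B (x : 'I_n -> R) := \sum_(i < n) (a i - b i) * x i + (e - u).
    rewrite [X in trigpoly X](_ : _ = fun x => 2^-1 * (cos (A x) + cos (B x))).
      by apply: trigpolyZ; apply: trigpolyD; exact: trigpoly_cos.
    apply/funext => x.
    set X := \sum_(i < n) a i * x i; set Y := \sum_(i < n) b i * x i.
    have -> : A x = (X + e) + (Y + u).
      by rewrite /A; under eq_bigr do rewrite mulrDl; rewrite big_split/= addrACA.
    have -> : B x = (X + e) - (Y + u).
      rewrite /B; under eq_bigr do rewrite mulrBl.
      by rewrite sumrB opprD addrACA.
    by rewrite (cosB (X + e)) (cosD (X + e)); field.
  + rewrite [X in trigpoly X](_ : _ = fun x =>
      cos (\sum_(i < n) a i * x i + e) * g x +
      cos (\sum_(i < n) a i * x i + e) * g' x); first exact: trigpolyD.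
    by apply/funext => x; rewrite mulrDr.
  + rewrite [X in trigpoly X](_ : _ = fun x =>
      c * (cos (\sum_(i < n) a i * x i + e) * g x)); first exact: trigpolyZ.
    by apply/funext => x; rewrite mulrCA.
- rewrite [X in trigpoly X](_ : _ = fun x => f x * g x + f' x * g x).
    by apply: trigpolyD; [exact: IHf|exact: IHf'].
  by apply/funext => x; rewrite mulrDl.
- rewrite [X in trigpoly X](_ : _ = fun x => c * (f x * g x)).
    by apply: trigpolyZ; exact: IHf.
  by apply/funext => x; rewrite mulrA.
Qed.

Lemma trigpoly_cst (c : R) : trigpoly (fun=> c).
Proof.
rewrite [X in trigpoly X](_ : _ =
  fun x => c * cos (\sum_(i < n) (fun=> 0) i * x i + 0)).
  by apply: trigpolyZ; exact: trigpoly_cos.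
by apply/funext => x; rewrite big1 ?addr0 ?cos0 ?mulr1// => i _; rewrite mul0r.
Qed.

Lemma trigpolyX (k : nat) f : trigpoly f -> trigpoly (fun x => f x ^+ k).
Proof.
move=> tf; elim: k => [|k IH]; first exact: trigpoly_cst.
rewrite [X in trigpoly X](_ : _ = fun x => f x * f x ^+ k).
  exact: trigpolyM.
by apply/funext => x; rewrite exprS.
Qed.

Lemma trigpoly_prod (I : Type) (r : seq I) (f : I -> ('I_n -> R) -> R) :
  (forall i, trigpoly (f i)) -> trigpoly (fun x => \prod_(i <- r) f i x).
Proof.
move=> tf; elim: r => [|i r IH].
  rewrite [X in trigpoly X](_ : _ = fun=> 1); first exact: trigpoly_cst.
  by apply/funext => x; rewrite big_nil.
rewrite [X in trigpoly X](_ : _ = fun x => f i x * \prod_(i <- r) f i x).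
  exact: trigpolyM.
by apply/funext => x; rewrite big_cons.
Qed.

Lemma trigpoly_sin_coord (i : 'I_n) (c e : R) :
  trigpoly (fun x => sin (c * x i + e)).
Proof.
rewrite [X in trigpoly X](_ : _ = fun x =>
    cos (\sum_(j < n) (if j == i then c else 0) * x j + (e - pi / 2))).
  exact: trigpoly_cos.
apply/funext => x; rewrite (bigD1 i)//= eqxx big1 ?addr0; last first.
  by move=> j /negbTE ->; rewrite mul0r.
by rewrite addrA [RHS]cosB cos_pihalf sin_pihalf mulr0 mulr1 add0r.
Qed.

Lemma trigpoly_bounded f : trigpoly f -> exists M, forall x, `|f x| <= M.
Proof.
elim=> {f} [a e|f g _ [M fM] _ [N gN]|c f _ [M fM]].
- by exists 1 => x; exact: normr_cos_le1.
- by exists (M + N) => x; rewrite (le_trans (ler_normD _ _))// lerD.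
- by exists (`|c| * M) => x; rewrite normrM ler_wpM2l.
Qed.

Lemma measurable_trigpoly d (T : measurableType d) (Z : 'I_n -> T -> R) f :
  (forall i, measurable_fun setT (Z i)) -> trigpoly f ->
  measurable_fun setT (fun w => f (fun i => Z i w)).
Proof.
move=> mZ; elim=> {f} [a e|f g _ mf _ mg|c f _ mf].
- apply: measurableT_comp.
    exact: continuous_measurable_fun (@continuous_cos R).
  apply: measurable_funD => //; apply: measurable_sum => i.
  exact: measurable_funM.
- exact: measurable_funD.
- exact: measurable_funM.
Qed.

Lemma integrable_trigpoly d (T : measurableType d) (P : probability T R)
    (Z : 'I_n -> T -> R) f :
  (forall i, measurable_fun setT (Z i)) -> trigpoly f ->
  P.-integrable setT (EFin \o (fun w => f (fun i => Z i w))).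
Proof.
move=> mZ tf; have [M fM] := trigpoly_bounded tf.
by apply: (@integrable_bounded _ _ _ P M) => //; exact: measurable_trigpoly.
Qed.

End trigonometric_polynomials.

Section cramer_wold.
Context d d' (T : measurableType d) (T' : measurableType d') (R : realType)
  (P : probability T R) (P' : probability T' R) (n : nat).
Variables (Z : 'I_n -> T -> R) (Z' : 'I_n -> T' -> R).
Hypotheses (mZ : forall i, measurable_fun setT (Z i))
  (mZ' : forall i, measurable_fun setT (Z' i)).
Hypothesis ZZ' : forall (a : 'I_n -> R) (e : R),
  \int[P]_w cos (\sum_(i < n) a i * Z i w + e) =
  \int[P']_w cos (\sum_(i < n) a i * Z' i w + e).

Lemma Rintegral_trigpoly f : @trigpoly R n f ->
  \int[P]_w f (fun i => Z i w) = \int[P']_w f (fun i => Z' i w).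
Proof.
elim=> {f} [a e|f g tf IHf tg IHg|c f tf IHf]; first exact: ZZ'.
- by rewrite !RintegralD ?IHf ?IHg//; exact: integrable_trigpoly.
- by rewrite !RintegralZl ?IHf//; exact: integrable_trigpoly.
Qed.

Let lim_trigpoly (F_ : nat -> ('I_n -> R) -> R) (F : ('I_n -> R) -> R) :
  (forall k x, `|F_ k x| <= 1) ->
  (forall k, measurable_fun setT (fun w => F_ k (fun i => Z i w))) ->
  (forall k, measurable_fun setT (fun w => F_ k (fun i => Z' i w))) ->
  measurable_fun setT (fun w => F (fun i => Z i w)) ->
  measurable_fun setT (fun w => F (fun i => Z' i w)) ->
  (forall x, F_ k x @[k --> \oo] --> F x) ->
  (forall k, \int[P]_w F_ k (fun i => Z i w) = \int[P']_w F_ k (fun i => Z' i w)) ->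
  \int[P]_w F (fun i => Z i w) = \int[P']_w F (fun i => Z' i w).
Proof.
move=> F1 m1 m2 m3 m4 Fcvg FE.
have c1 := @bounded_cvg_Rintegral _ _ _ P 1 (fun k w => F_ k (fun i => Z i w)) _ m1 m3
  (fun w => Fcvg _) (fun k w => F1 k _).
have c2 := @bounded_cvg_Rintegral _ _ _ P' 1 (fun k w => F_ k (fun i => Z' i w)) _ m2 m4
  (fun w => Fcvg _) (fun k w => F1 k _).
rewrite (_ : (fun k => _) = (fun k => \int[P']_w F_ k (fun i => Z' i w))) in c1.
  exact: cvg_unique c1 c2.
by apply/funext => k; exact: FE.
Qed.

Let cvg_prodr (F_ : nat -> 'I_n -> R) (F : 'I_n -> R) :
  (forall i, F_ k i @[k --> \oo] --> F i) ->
  \prod_(i < n) F_ k i @[k --> \oo] --> \prod_(i < n) F i.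
Proof.
move=> Fcvg; elim: (index_enum 'I_n) => [|i r IH].
  by rewrite big_nil; under eq_fun do rewrite big_nil; exact: cvg_cst.
rewrite big_cons; under eq_fun do rewrite big_cons.
by apply: cvgM; [exact: Fcvg|exact: IH].
Qed.

Let indic_prod_le1 (c : 'I_n -> bool) : `|\prod_(i < n) (c i)%:R : R| <= 1.
Proof.
rewrite ger0_norm ?prodr_ge0//.
by apply: prodr_ile1 => i _; rewrite ler0n lern1 leq_b1.
Qed.

(** Two successive bounded limits: [k] to infinity turns [F_ N k] into the indicator that all sines
    [s N x i] are negative, then [N] to infinity turns negativity of the sine into [x i < a i]. The
    two limits stay separate because the sine is periodic and agrees in sign with its argument only
    near 0. *)
Lemma Rintegral_box (a : 'I_n -> R) :
  \int[P]_w \prod_(i < n) (Z i w < a i)%R%:R =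
  \int[P']_w \prod_(i < n) (Z' i w < a i)%R%:R.
Proof.
pose s N (x : 'I_n -> R) i := sin (N.+1%:R^-1 * x i - N.+1%:R^-1 * a i).
(* Affine image of the sine in [[0, 1]], placing the sign change at the threshold 1/2 of
   [cvg_poly_step]. *)
pose p N x i := 2^-1 + 2^-1 * s N x i.
have p01 N x i : 0 <= p N x i <= 1.
  by rewrite /p /s; have := normr_sin_le1 (N.+1%:R^-1 * x i - N.+1%:R^-1 * a i);
    rewrite ler_norml => /andP[]; move: (sin _) => v; lra.
pose F_ N k x := \prod_(i < n) (1 - p N x i ^+ k) ^+ (k * 2 ^ k).
have tF N k : trigpoly (F_ N k).
  apply: trigpoly_prod => i; apply: trigpolyX.
  apply: trigpolyD; first exact: trigpoly_cst.
  rewrite [X in trigpoly X](_ : _ = fun x => -1 * p N x i ^+ k); last first.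
    by apply/funext => x; rewrite mulN1r.
  apply: trigpolyZ; apply: trigpolyX; apply: trigpolyD; first exact: trigpoly_cst.
  by apply: trigpolyZ; exact: trigpoly_sin_coord.
have F1 N k x : `|F_ N k x| <= 1.
  have h i : 0 <= 1 - p N x i ^+ k <= 1.
    have /andP[p0 p1] := p01 N x i.
    by rewrite subr_ge0 exprn_ile1// gerBl exprn_ge0.
  rewrite ger0_norm; first by apply: prodr_ile1 => i _; have /andP[h0 h1] := h i;
    rewrite exprn_ge0// exprn_ile1.
  by apply: prodr_ge0 => i _; have /andP[h0 h1] := h i; rewrite exprn_ge0.
pose G N x := \prod_(i < n) (s N x i < 0)%R%:R : R.
have ms N i d0 (S : measurableType d0) (Y : 'I_n -> S -> R) :
    (forall i, measurable_fun setT (Y i)) ->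
    measurable_fun setT (fun w => s N (Y ^~ w) i).
  move=> mY; apply: measurableT_comp.
    exact: continuous_measurable_fun (@continuous_sin R).
  by apply: measurable_funB => //; exact: measurable_funM.
have mlt d0 (S : measurableType d0) (Y : S -> R) c : measurable_fun setT Y ->
    measurable_fun setT (fun w => (Y w < c)%R%:R : R).
  move=> mY; rewrite (_ : (fun w => _) = \1_(Y @^-1` `]-oo, c[)).
    apply: measurable_indic; rewrite -[X in measurable X]setTI.
    exact: mY.
  by apply/funext => w; rewrite indicE; congr (nat_of_bool _)%:R;
    apply/idP/idP; rewrite inE /= in_itv.
have mG N d0 (S : measurableType d0) (Y : 'I_n -> S -> R) :
    (forall i, measurable_fun setT (Y i)) ->
    measurable_fun setT (fun w => G N (Y ^~ w)).
  by move=> mY; apply: measurable_prod => i _; apply: mlt; exact: ms.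
have EG N : \int[P]_w G N (fun i => Z i w) = \int[P']_w G N (fun i => Z' i w).
  apply: (@lim_trigpoly (F_ N)) => //.
  - by move=> k; exact: measurable_trigpoly.
  - by move=> k; exact: measurable_trigpoly.
  - exact: mG.
  - exact: mG.
  - move=> x; apply: cvg_prodr => i.
    have := cvg_poly_step (p01 N x i).
    rewrite (_ : (p N x i < 2^-1) = (s N x i < 0)) => [h|]; first exact: h.
    by rewrite /p gtrDl pmulr_rlt0.
  - by move=> k; exact: Rintegral_trigpoly.
apply: (@lim_trigpoly G (fun x => \prod_(i < n) (x i < a i)%R%:R)) => //.
- by move=> k x; exact: indic_prod_le1.
- by move=> k; exact: mG.
- by move=> k; exact: mG.
- by apply: measurable_prod => i _; exact: mlt.
- by apply: measurable_prod => i _; exact: mlt.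
move=> x; apply: cvg_prodr => i; apply: cvg_near_cst.
(* From this rank on the argument of the sine lies in []-1, 1[], where sine and argument have the
   same sign because [1 < pi]. *)
exists (Num.truncn `|x i - a i|) => // N /= hN; congr (nat_of_bool _)%:R.
have xaN : `|x i - a i| < N.+1%:R.
  by rewrite (lt_le_trans (truncnS_gt _))// ler_nat ltnS.
rewrite /s -mulrBr.
have N0 : (0 : R) < N.+1%:R by [].
set y := _ * _.
have y1 : `|y| < 1.
  by rewrite /y normrM gtr0_norm ?invr_gt0// mulrC ltr_pdivrMr// mul1r.
have pi1 : (1 : R) < pi by rewrite (lt_le_trans _ (pi_ge2 _))// ltr1n.
have yE : (y < 0) = (x i < a i) by rewrite /y pmulr_rlt0 ?invr_gt0// subr_lt0.
rewrite -yE.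
have [y0|y0|->] := ltgtP y 0; last by rewrite sin0 ltxx.
  rewrite -[y]opprK sinN oppr_lt0 sin_gt0_pi// oppr_gt0 y0/=.
  by rewrite (lt_trans _ pi1)//; move: y1; rewrite ltr_norml => /andP[]; lra.
apply/negbTE; rewrite -leNgt ltW// sin_gt0_pi// y0/=.
by rewrite (lt_trans _ pi1)//; move: y1; rewrite ltr_norml => /andP[].
Qed.

Lemma probability_box (a : 'I_n -> R) :
  P [set w | forall i, Z i w < a i] = P' [set w | forall i, Z' i w < a i].
Proof.
have key d0 (S : measurableType d0) (Q : probability S R) (Y : 'I_n -> S -> R) :
    (forall i, measurable_fun setT (Y i)) ->
    Q [set w | forall i, Y i w < a i] =
    (\int[Q]_w \prod_(i < n) (Y i w < a i)%R%:R)%:E.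
  move=> mY.
  have mB : measurable [set w | forall i, Y i w < a i].
    rewrite (_ : [set w | _] = \bigcap_(i in [set: 'I_n]) (Y i @^-1` `]-oo, a i[)).
      apply: fin_bigcap_measurable; first exact: finite_finset.
      by move=> i _; rewrite -[X in measurable X]setTI; exact: mY.
    apply/seteqP; split => w /= h i; first by rewrite /= in_itv/= h.
    by have := h i I; rewrite /= in_itv.
  rewrite /Rintegral (_ : (fun w => _) = EFin \o \1_([set w | forall i, Y i w < a i])).
    by rewrite integral_indic// setIT fineK// fin_num_measure.
  apply/funext => w /=; congr EFin; rewrite indicE.
  have [|] := boolP (w \in _).
    by rewrite inE => h; rewrite big1// => i _; rewrite h.
  move=> /negP h; apply/eqP/prodf_eq0 => /=.
  apply: contrapT => h'; apply: h; rewrite inE => i /=.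
  apply: contrapT => /negP nA; apply: h'; exists i => //.
  by rewrite (negbTE nA).
by rewrite !key// Rintegral_box.
Qed.

End cramer_wold.

(** * From finite-dimensional laws to the law on path space *)

Section finite_dimensional_laws.
Context {R : realType}.
Let path := {nonneg R} -> R.

(** Lists make intersection a concatenation and the whole space the empty list; a time may occur
    several times. *)
Let box (s : seq ({nonneg R} * R)) : set path :=
  [set x : path | all (fun p => x p.1 < p.2) s].

Let boxes : set (set path) := range box.

Let boxesI : setI_closed boxes.
Proof.
move=> _ _ [s1 _ <-] [s2 _ <-]; exists (s1 ++ s2) => //.
apply/seteqP; split => x; rewrite /box /= all_cat; first by move=> /andP[].
by move=> [-> ->].
Qed.

Let cylinders_sub : <<s @cylinders R >> `<=` <<s boxes >>.
Proof.
apply: smallest_sub; first exact: smallest_sigma_algebra.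
move=> _ [t [A [mA ->]]].
pose f : g_sigma_algebraType boxes -> R := fun x => x t.
have mf : measurable_fun setT f.
  apply: (measurability _ (RGenInftyO.measurableE R)) => _ [_ [a ->] <-].
  rewrite setTI; apply: sub_sigma_algebra; exists [:: (t, a)] => //.
  by apply/seteqP; split => x; rewrite /box /f /= andbT in_itv.
by have := mf measurableT A mA; rewrite setTI.
Qed.

Let measurable_sample_path d (T : measurableType d) (X : R -> T -> R) :
  (forall t, 0 <= t -> measurable_fun setT (X t)) ->
  measurable_fun setT (sample_path X : T -> g_sigma_algebraType boxes).
Proof.
move=> mX; apply: (@measurability _ _ T (g_sigma_algebraType boxes) setT
  (sample_path X) boxes) => [//|] _ [_ [s _ <-] <-].
rewrite setTI; elim: s => [|[t a] s IH].
  rewrite (_ : _ @^-1` _ = setT)//; apply/seteqP; split => //.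
rewrite (_ : _ @^-1` _ = (X t%:num @^-1` `]-oo, a[) `&` (sample_path X @^-1` box s)).
  by apply: measurableI => //; rewrite -[X in measurable X]setTI; exact: mX.
apply/seteqP; split => w; rewrite /box /sample_path /= in_itv/=.
  by move=> /andP[].
by move=> [-> ->].
Qed.

(** The boxes form a pi-system whose sigma-algebra contains the cylinders, so Dynkin's theorem
    reduces equality of laws to boxes, where equality of the cosine integrals decides. *)
Lemma same_distribution_cos d d' (T : measurableType d) (T' : measurableType d')
    (P : probability T R) (P' : probability T' R)
    (X : R -> T -> R) (X' : R -> T' -> R) :
  (forall t, 0 <= t -> measurable_fun setT (X t)) ->
  (forall t, 0 <= t -> measurable_fun setT (X' t)) ->
  (forall (n : nat) (t a : 'I_n -> R) (e : R), (forall i, 0 <= t i) ->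
    \int[P]_w cos (\sum_(i < n) a i * X (t i) w + e) =
    \int[P']_w cos (\sum_(i < n) a i * X' (t i) w + e)) ->
  same_distribution P X P' X'.
Proof.
move=> mX mX' XX' E /cylinders_sub; move: E.
have mpX := measurable_sample_path mX.
have mpX' := measurable_sample_path mX'.
have mpre (S : set (g_sigma_algebraType boxes)) : measurable S ->
    measurable (sample_path X @^-1` S).
  by move=> mS; rewrite -[X in measurable X]setTI; exact: mpX.
have mpre' (S : set (g_sigma_algebraType boxes)) : measurable S ->
    measurable (sample_path X' @^-1` S).
  by move=> mS; rewrite -[X in measurable X]setTI; exact: mpX'.
apply: (@dynkin_induction _ (g_sigma_algebraType boxes)) => //.
- by rewrite !preimage_setT !probability_setT.
- move=> _ [s _ <-].
  pose p0 : {nonneg R} * R := (NngNum (lexx 0), 0).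
  pose t (i : 'I_(size s)) : R := (nth p0 s i).1%:num.
  pose a (i : 'I_(size s)) : R := (nth p0 s i).2.
  have t0 (i : 'I_(size s)) : 0 <= t i by rewrite /t.
  have := @probability_box _ _ _ _ _ P P' _ (fun i => X (t i)) (fun i => X' (t i))
    (fun i => mX _ (t0 i)) (fun i => mX' _ (t0 i)) (fun b e => XX' _ t b e t0) a.
  have bE (S : Type) (Y : R -> S -> R) :
      [set w | forall i, Y (t i) w < a i] = sample_path Y @^-1` box s.
    apply/seteqP; split => w /= h.
      by apply/(all_nthP p0) => i si; exact: (h (Ordinal si)).
    by move=> i; have /(all_nthP p0) := h; apply.
  by rewrite (bE T X) (bE T' X').
- move=> S mS PS; rewrite 2!preimage_setC.
  by rewrite (probability_setC P (mpre _ mS)) (probability_setC P' (mpre' _ mS)) PS.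
- move=> F mF tF PF; rewrite 2!preimage_bigcup.
  have trivP (S : Type) (Y : R -> S -> R) :
      trivIset setT (fun k => sample_path Y @^-1` F k).
    by move=> i j _ _ [w [/= Fi Fj]]; apply: tF => //; exists (sample_path Y w).
  rewrite (measure_bigcup P) ?(measure_bigcup P')//.
  + by apply: eq_eseriesr => k _; exact: PF.
  + by move=> k _; exact: mpre'.
  + by move=> k _; exact: mpre.
Qed.

End finite_dimensional_laws.

(** * Limits in L^2 *)

(** The L^2 distances may be infinite for the first indices; this form handles that without a
    separate finiteness argument. *)
Lemma cvge0P (R : realType) (u : nat -> \bar R) : (forall k, (0 <= u k)%E) ->
  u k @[k --> \oo] --> 0%E <->
  (forall e : R, 0 < e -> \forall k \near \oo, (u k <= e%:E)%E).
Proof.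
move=> u0; split=> [/fine_cvgP[ufin ucvg] e e0|ue].
  move/cvgrPdist_le : ucvg => /(_ _ e0); apply: filterS2 ufin => k ukfin.
  rewrite sub0r normrN /= ger0_norm ?fine_ge0// => uke.
  by rewrite -(fineK ukfin) lee_fin.
have ufin : \forall k \near \oo, u k \is a fin_num.
  apply: filterS (ue 1 ltr01) => k uk1.
  by rewrite ge0_fin_numE// (le_lt_trans uk1)// ltry.
apply/fine_cvgP; split => //; apply/cvgrPdist_le => e e0.
apply: filterS2 ufin (ue _ e0) => k ukfin uke.
by rewrite sub0r normrN /= ger0_norm ?fine_ge0// -lee_fin fineK.
Qed.

(** Cauchy-Schwarz against the constant vector: sum [a i * a j <= (a i ^+ 2 + a j ^+ 2) / 2] over
    all pairs. *)
Lemma sqr_sum_le (R : realType) (n : nat) (a : 'I_n -> R) :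
  (\sum_(i < n) a i) ^+ 2 <= n%:R * \sum_(i < n) a i ^+ 2.
Proof.
have -> : n%:R * \sum_(i < n) a i ^+ 2 =
    \sum_(i < n) \sum_(j < n) (2^-1 * a i ^+ 2 + 2^-1 * a j ^+ 2).
  rewrite [RHS](eq_bigr (fun i => n%:R * (2^-1 * a i ^+ 2) +
      2^-1 * \sum_(j < n) a j ^+ 2)); last first.
    by move=> i _; rewrite big_split/= sumr_const card_ord -[_ *+ n]mulr_natl big_distrr.
  rewrite [RHS]big_split/= sumr_const card_ord -[_ *+ n]mulr_natl -!big_distrr/=.
  by field.
rewrite expr2 big_distrl/=; apply: ler_sum => i _.
rewrite big_distrr/=; apply: ler_sum => j _.
by have := sqr_ge0 (a i - a j); nra.
Qed.

Lemma L2_cvg_sum d (T : measurableType d) (R : realType)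
    (mu : {measure set T -> \bar R}) (D : set T) (n : nat) (c : 'I_n -> R)
    (F : nat -> 'I_n -> T -> R) : measurable D ->
  (forall k i, measurable_fun D (F k i)) ->
  (forall i, (\int[mu]_(x in D) (F k i x ^+ 2)%:E)%E @[k --> \oo] --> 0%E) ->
  (\int[mu]_(x in D) ((\sum_(i < n) c i * F k i x) ^+ 2)%:E)%E @[k --> \oo] --> 0%E.
Proof.
move=> mD mF F0.
have int0 (f : T -> R) : (0 <= \int[mu]_(x in D) (f x ^+ 2)%:E)%E.
  by apply: integral_ge0 => x _; rewrite lee_fin sqr_ge0.
apply/cvge0P => [k|e e0]; first exact: int0.
(* The total weight left by [sqr_sum_le]; the added 1 keeps [e / s] meaningful when all coefficients
   vanish. *)
pose s := 1 + \sum_(i < n) n%:R * c i ^+ 2.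
have s0 : 0 < s.
  by rewrite ltr_pwDl// sumr_ge0// => i _; rewrite mulr_ge0 ?sqr_ge0.
have es0 : 0 < e / s by rewrite divr_gt0.
have : \forall k \near \oo, forall i,
    (\int[mu]_(x in D) (F k i x ^+ 2)%:E <= (e / s)%:E)%E.
  apply: filter_forall => i.
  exact: (cvge0P (fun k => int0 (F k i))).1 (F0 i) _ es0.
apply: filterS => k Fk.
have nc i : 0 <= n%:R * c i ^+ 2 by rewrite mulr_ge0 ?sqr_ge0.
have mF2 i : measurable_fun D (fun x => ((n%:R * c i ^+ 2) * F k i x ^+ 2)%:E).
  by apply/measurable_EFinP/measurable_funM => //; exact: measurable_funX.
apply: (@le_trans _ _ (\int[mu]_(x in D)
    (\sum_(i < n) ((n%:R * c i ^+ 2) * F k i x ^+ 2)%:E))%E).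
  apply: ge0_le_integral => //.
  - by move=> x _; rewrite lee_fin sqr_ge0.
  - apply/measurable_EFinP/measurable_funX/measurable_sum => i.
    exact: measurable_funM.
  - exact: emeasurable_sum.
  - move=> x _; rewrite sumEFin lee_fin (le_trans (sqr_sum_le _))//.
    rewrite big_distrr/=; apply: ler_sum => i _.
    by rewrite exprMn mulrA.
rewrite ge0_integral_sum//; last first.
  by move=> i x _; rewrite lee_fin mulr_ge0 ?sqr_ge0.
apply: (@le_trans _ _ (\sum_(i < n) ((n%:R * c i ^+ 2) * (e / s))%:E)%E).
  apply: lee_sum => i _.
  under eq_integral do rewrite EFinM.
  rewrite ge0_integralZl//; last 3 first.
  - by apply/measurable_EFinP; exact: measurable_funX.
  - by move=> x _; rewrite lee_fin sqr_ge0.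
  - by rewrite lee_fin.
  by rewrite [leRHS]EFinM lee_wpmul2l ?lee_fin.
rewrite sumEFin lee_fin -big_distrl/= mulrCA ler_piMr//; first exact: ltW.
by rewrite ler_pdivrMr// mul1r /s lerDr.
Qed.

Lemma normr_sin_le (R : realType) (x : R) : `|sin x| <= `|x|.
Proof.
wlog x0 : x / 0 <= x.
  move=> h; have [x0|/ltW x0] := leP 0 x; first exact: h.
  by rewrite -(normrN x) -(normrN (sin x)) -sinN h// oppr_ge0.
have [->|xn0] := eqVneq x 0; first by rewrite sin0 normr0.
have xp : 0 < x by rewrite lt_neqAle eq_sym xn0.
have dsin (y : R) : y \in `]0, x[ -> is_derive y (1 : R) sin (cos y).
  by move=> _; exact: is_derive_sin.
have [|c _] := @MVT _ sin cos 0 x xp dsin.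
  by apply: continuous_subspaceT => y; exact: continuous_sin.
rewrite sin0 !subr0 => ->.
by rewrite normrM ler_piMl// normr_cos_le1.
Qed.

Lemma normr_cosB_le (R : realType) (x y : R) : `|cos x - cos y| <= `|x - y|.
Proof.
have -> : cos x - cos y = - 2 * sin ((x + y) / 2) * sin ((x - y) / 2).
  set u := (x + y) / 2; set v := (x - y) / 2.
  transitivity (cos (u + v) - cos (u - v)).
    by congr (cos _ - cos _); rewrite /u /v; field.
  by rewrite cosD cosB; ring.
have h1 := normr_sin_le1 ((x + y) / 2).
have h2 := normr_sin_le ((x - y) / 2).
have h3 : `|(x - y) / 2| = `|x - y| / 2.
  by rewrite normrM (@ger0_norm _ 2^-1).
rewrite h3 in h2; rewrite 2!normrM normrN normr_nat.
move: (normr_ge0 (sin ((x - y) / 2))) (normr_ge0 (sin ((x + y) / 2))).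
move: `|sin ((x + y) / 2)| `|sin ((x - y) / 2)| `|x - y| h1 h2 {h3}.
by move=> a b z h1 h2 b0 a0; nra.
Qed.

Lemma L2_cvg_Rintegral_cos d (T : measurableType d) (R : realType)
    (P : probability T R) (A_ : nat -> T -> R) (A : T -> R) :
  (forall k, measurable_fun setT (A_ k)) -> measurable_fun setT A ->
  (\int[P]_w ((A_ k w - A w) ^+ 2)%:E)%E @[k --> \oo] --> 0%E ->
  \int[P]_w cos (A_ k w) @[k --> \oo] --> \int[P]_w cos (A w).
Proof.
have int0 k : (0 <= \int[P]_w ((A_ k w - A w) ^+ 2)%:E)%E.
  by apply: integral_ge0 => w _; rewrite lee_fin sqr_ge0.
move=> mA_ mA /(cvge0P int0) cv.
have mcos (f : T -> R) : measurable_fun setT f -> measurable_fun setT (cos \o f).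
  move=> mf; apply: measurableT_comp => //.
  exact: continuous_measurable_fun (@continuous_cos R).
have icos (f : T -> R) : measurable_fun setT f ->
    P.-integrable setT (EFin \o (fun w => cos (f w))).
  move=> mf; apply: (@integrable_bounded _ _ _ P 1); first exact: mcos.
  by move=> w; exact: normr_cos_le1.
(* Cosine is 1-Lipschitz and [z <= r + z^2 / r] for [z >= 0]. Once the mean square is at most [r^2],
   the difference of integrals is at most [r + r = e]. *)
apply/cvgrPdist_le => e e0; pose r := e / 2.
have r0 : 0 < r by rewrite divr_gt0.
have r20 : 0 < r ^+ 2 by rewrite exprn_gt0.
apply: filterS (cv _ r20) => k kr.
rewrite distrC -RintegralB ?icos//.
have mB : measurable_fun setT (fun w => A_ k w - A w) by exact: measurable_funB.
have isq : P.-integrable setT (EFin \o (fun w => (A_ k w - A w) ^+ 2)).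
  apply/integrableP; split; first by apply/measurable_EFinP; exact: measurable_funX.
  under eq_integral do rewrite /= ger0_norm ?sqr_ge0//.
  by rewrite (le_lt_trans kr)// ltry.
have isr : P.-integrable setT (EFin \o (fun w => r^-1 * (A_ k w - A w) ^+ 2)).
  by rewrite /comp; under eq_fun do rewrite EFinM; apply: integrableZl.
have icst : P.-integrable setT (EFin \o cst r).
  by apply: (@integrable_bounded _ _ _ P `|r|).
have idf : P.-integrable setT (EFin \o (fun w => cos (A_ k w) - cos (A w))).
  by rewrite /comp; under eq_fun do rewrite EFinB; apply: integrableB => //; exact: icos.
apply: le_trans (le_normr_Rintegral _ idf) _ => //.
apply: (@le_trans _ _ (\int[P]_w (cst r w + r^-1 * (A_ k w - A w) ^+ 2))).
  apply: le_Rintegral => //.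
  - exact: (integrable_norm idf).
  - by apply: (integrableD _ icst isr).
  - move=> w _; rewrite (le_trans (normr_cosB_le _ _))//=.
    rewrite -(real_normK (num_real (A_ k w - A w))).
    move: (normr_ge0 (A_ k w - A w)); move: `|_| => z z0.
    rewrite -(ler_pM2l r0) mulrDr mulVKf ?gt_eqF//.
    by have := sqr_ge0 (r - z); nra.
have PT : fine (P setT) = 1 by rewrite probability_setT.
have Ecst : \int[P]_w cst r w = r by rewrite Rintegral_cst// PT mulr1.
rewrite RintegralD// Ecst RintegralZl//.
have : \int[P]_w (A_ k w - A w) ^+ 2 <= r ^+ 2.
  rewrite -lee_fin /Rintegral fineK//; exact: integrable_fin_num isq.
move: (Rintegral _ _ _) => z zr.
have -> : e = r + r by rewrite /r; field.
by rewrite lerD2l mulrC ler_pdivrMr// -expr2.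
Qed.

Lemma L2_cvg_Rintegral_sqr d (T : measurableType d) (R : realType)
    (mu : {measure set T -> \bar R}) (D : set T) (g_ : nat -> T -> R)
    (g : T -> R) : measurable D ->
  (forall k, measurable_fun D (g_ k)) -> measurable_fun D g ->
  mu.-integrable D (EFin \o (fun x => g x ^+ 2)) ->
  (\int[mu]_(x in D) ((g_ k x - g x) ^+ 2)%:E)%E @[k --> \oo] --> 0%E ->
  \int[mu]_(x in D) (g_ k x ^+ 2) @[k --> \oo] --> \int[mu]_(x in D) (g x ^+ 2).
Proof.
have int0 k : (0 <= \int[mu]_(x in D) ((g_ k x - g x) ^+ 2)%:E)%E.
  by apply: integral_ge0 => w _; rewrite lee_fin sqr_ge0.
move=> mD mg_ mg ig /(cvge0P int0) cv.
pose V := \int[mu]_(x in D) (g x ^+ 2).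
have V0 : 0 <= V by apply: Rintegral_ge0 => x _; rewrite sqr_ge0.
(* The final bound is [r V + (1 + 1 / r) r^2 = r V + r^2 + r], at most [r (V + 2)] because
   [r <= 1]. *)
apply/cvgrPdist_le => e e0; pose r := Num.min 1 (e / (V + 2)).
have V2 : 0 < V + 2 by rewrite ltr_wpDl.
have r0 : 0 < r by rewrite lt_min ltr01/= divr_gt0.
have r1 : r <= 1 by rewrite ge_min lexx.
have re : r * (V + 2) <= e by rewrite -ler_pdivlMr// ge_min lexx orbT.
have r20 : 0 < r ^+ 2 by rewrite exprn_gt0.
apply: filterS (cv _ r20) => k kr.
have mB : measurable_fun D (fun w => g_ k w - g w) by exact: measurable_funB.
have isq : mu.-integrable D (EFin \o (fun w => (g_ k w - g w) ^+ 2)).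
  apply/integrableP; split; first by apply/measurable_EFinP; exact: measurable_funX.
  under eq_integral do rewrite /= ger0_norm ?sqr_ge0//.
  by rewrite (le_lt_trans kr)// ltry.
have iZ (c : R) (f : T -> R) : mu.-integrable D (EFin \o f) ->
    mu.-integrable D (EFin \o (fun w => c * f w)).
  by move=> fi; rewrite /comp; under eq_fun do rewrite EFinM; apply: integrableZl.
have iDD (f f' : T -> R) : mu.-integrable D (EFin \o f) ->
    mu.-integrable D (EFin \o f') -> mu.-integrable D (EFin \o (fun w => f w + f' w)).
  by move=> fi fi'; apply: (integrableD _ fi fi').
have igk : mu.-integrable D (EFin \o (fun x => g_ k x ^+ 2)).
  apply: (@le_integrable _ _ R mu _ _ _ _ _ _
    (iDD _ _ (iZ 2 _ ig) (iZ 2 _ isq))) => //.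
    by apply/measurable_EFinP; exact: measurable_funX.
  move=> x _; rewrite lee_fin (ger0_norm (sqr_ge0 (g_ k x))) ger0_norm; last first.
    by apply: addr_ge0; apply: mulr_ge0 => //; exact: sqr_ge0.
  by have := sqr_ge0 (g_ k x - 2 * g x); nra.
rewrite distrC -RintegralB//.
have idf : mu.-integrable D (EFin \o (fun x => g_ k x ^+ 2 - g x ^+ 2)).
  by apply: (integrableB _ igk ig).
apply: le_trans (le_normr_Rintegral _ idf) _ => //.
have c0 : 0 <= 1 + r^-1 by rewrite addr_ge0// invr_ge0 ltW.
apply: (@le_trans _ _ (\int[mu]_(x in D)
    (r * g x ^+ 2 + (1 + r^-1) * (g_ k x - g x) ^+ 2))).
  apply: le_Rintegral => //.
  - exact: (integrable_norm idf).
  - by apply: iDD; apply: iZ.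
  - move=> x _; move: (g_ k x) (g x) => a b.
    (* a^2 - b^2 = (a - b)^2 + 2 b (a - b), and 2 |b (a - b)| <= r b^2 + (a - b)^2 / r *)
    have h : `|2 * b * (a - b)| <= r * b ^+ 2 + r^-1 * (a - b) ^+ 2.
      have h0 : r * (r * b ^+ 2 + r^-1 * (a - b) ^+ 2) = (r * b) ^+ 2 + (a - b) ^+ 2.
        by rewrite mulrDr mulVKf ?gt_eqF//; ring.
      rewrite -(ler_pM2l r0) h0 -{1}(gtr0_norm r0) -normrM ler_norml.
      have h1 := sqr_ge0 (r * b - (a - b)); have h2 := sqr_ge0 (r * b + (a - b)).
      by apply/andP; split; lra.
    rewrite (_ : a ^+ 2 - b ^+ 2 = (a - b) ^+ 2 + 2 * b * (a - b)); last by ring.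
    rewrite (le_trans (ler_normD _ _))// ger0_norm ?sqr_ge0//.
    rewrite [leRHS](_ : _ = (a - b) ^+ 2 + (r * b ^+ 2 + r^-1 * (a - b) ^+ 2)).
      by rewrite lerD2l.
    by ring.
rewrite RintegralD ?iZ// !RintegralZl//.
have : \int[mu]_(x in D) (g_ k x - g x) ^+ 2 <= r ^+ 2.
  rewrite -lee_fin /Rintegral fineK//; exact: integrable_fin_num isq.
move: (\int[mu]_(x in D) (g_ k x - g x) ^+ 2) => z zr.
apply: le_trans re; rewrite mulrDr lerD2l.
apply: (@le_trans _ _ ((1 + r^-1) * r ^+ 2)); first by rewrite ler_wpM2l.
rewrite mulrDl mul1r expr2 mulrA mulVf ?gt_eqF// mul1r.
by nra.
Qed.

Lemma process_sigma_algebra_sum d (T : measurableType d) (R : realType)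
    (P : probability T R) (X : R -> {RV P >-> R}) (I : Type) (r : seq I)
    (c t : I -> R) (A : set R) :
  (forall i, 0 <= t i) -> measurable A ->
  process_sigma_algebra X ((fun w => \sum_(i <- r) c i * X (t i) w) @^-1` A).
Proof.
move=> t0 mA.
pose G := [set E | exists t : R, exists A : set R,
  [/\ 0 <= t, measurable A & E = X t @^-1` A]].
have mX i : measurable_fun setT (X (t i) : g_sigma_algebraType G -> R).
  move=> _ B mB; rewrite setTI; apply: sub_sigma_algebra.
  by exists (t i), B; split.
have mS : measurable_fun setT
    ((fun w => \sum_(i <- r) c i * X (t i) w) : g_sigma_algebraType G -> R).
  by apply: measurable_sum => i; exact: measurable_funM.
by have := mS measurableT A mA; rewrite setTI.
Qed.

Lemma independent_family_pair d (T : measurableType d) (R : realType)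
    (P : probability T R) (U V : T -> R) :
  (forall A B, measurable A -> measurable B ->
    P (U @^-1` A `&` V @^-1` B) = (P (U @^-1` A) * P (V @^-1` B))%E) ->
  independent_family P (fun (i : 'I_2) => if i == ord0 then U else V).
Proof.
move=> UV A mA; rewrite big_ord_recl big_ord1 /= -UV//; congr (P _).
apply/seteqP; split => w /= h.
  by split; [exact: (h ord0 I)|exact: (h (lift ord0 ord0) I)].
move=> i _; case: (unliftP ord0 i) => [j ->|->] /=; last exact: h.1.
by rewrite ord1; exact: h.2.
Qed.

(** * Wiener integrals together with an independent Gaussian process *)

Section wiener_integrals.
Context d (T : measurableType d) (R : realType) (P : probability T R).
Variables (W B : R -> {RV P >-> R}) (C : R -> R -> R).
Hypotheses (bW : brownian_motion W) (gB : centered_gaussian_process B C).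
Hypothesis indWB : independent_processes W B.

(** Each increment is split into its two endpoints. One list then encodes both the step function,
    through the indicators of []0, u]], and its integral, through the values [W u]. *)
Let steps (n : nat) (t a : nat -> R) : seq (R * R) :=
  [seq (a j, t j.+1) | j <- iota 0 n] ++ [seq (- a j, t j) | j <- iota 0 n].

Let sum_steps (n : nat) (t a : nat -> R) (F : R -> R) :
  \sum_(p <- steps n t a) p.1 * F p.2 = \sum_(i < n) a i * (F (t i.+1) - F (t i)).
Proof.
rewrite big_cat !big_map -!/(index_iota 0 n) /=.
rewrite -{1 2}[n]subn0 -!/(index_iota 0 n) !big_mkord -big_split/=.
by apply: eq_bigr => i _; rewrite mulNr -mulrBr.
Qed.

(** For fixed [k], [SL k] is a finite combination of values of [W], hence independent of [V], and
    the cosine integral factorizes with exponent [v k + q]. Both the integral and [v k] converge,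
    the latter to the squared norm of [g], and uniqueness of limits concludes. *)
Lemma Rintegral_cos_wiener (m : nat) (f : 'I_m -> R -> R)
    (Y : 'I_m -> {RV P >-> R}) (c b t : 'I_m -> R) (e : R) :
  (forall i, is_wiener_integral W (f i) (Y i)) -> (forall i, 0 <= t i) ->
  \int[P]_w cos (\sum_(i < m) (c i * Y i w + b i * B (t i) w) + e) =
  cos e * expR (- ((\int[lebesgue_measure]_(x in `[0, +oo[)
      (\sum_(i < m) c i * f i x) ^+ 2 +
    \sum_(i < m) \sum_(j < m) b i * b j * C (t i) (t j)) / 2)).
Proof.
move=> wY t0.
pose mu := @lebesgue_measure R.
pose D : set (measurableTypeR R) := `[0, +oo[%classic.
have mD : measurable D by exact: measurable_itv.
have /choice[S hS] : forall i, exists S : (nat -> nat) * (nat -> nat -> R) * (nat -> nat -> R),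
    [/\ forall k, 0 <= S.1.2 k 0%N /\ {homo S.1.2 k : i j / (i <= j)%N >-> i <= j},
      (\int[mu]_(x in D)
        ((step_function (S.1.1 k) (S.1.2 k) (S.2 k) x - f i x) ^+ 2)%:E)%E
          @[k --> \oo] --> 0%E
    & ('E_P[fun w =>
        ((step_wiener_integral W (S.1.1 k) (S.1.2 k) (S.2 k) w - Y i w) ^+ 2)%R])%E
          @[k --> \oo] --> 0%E].
  move=> i; have [_ _ [n [u [a [h1 h2 h3]]]]] := wY i.
  by exists (n, u, a); split.
pose g x := \sum_(i < m) c i * f i x.
pose q := \sum_(i < m) \sum_(j < m) b i * b j * C (t i) (t j).
pose st k i := steps ((S i).1.1 k) ((S i).1.2 k) ((S i).2 k).
(* The approximations of the different [f i] have unrelated partitions; concatenating their lists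
   suffices, as no common refinement is required. *)
pose L k := flatten [seq [seq (c i * p.1, p.2) | p <- st k i] | i <- index_enum 'I_m].
have sumL k (F : R -> R) : \sum_(p <- L k) p.1 * F p.2 =
    \sum_(i < m) c i * \sum_(j < (S i).1.1 k) (S i).2 k j *
      (F ((S i).1.2 k j.+1) - F ((S i).1.2 k j)).
  rewrite big_flatten big_map; apply: eq_bigr => i _.
  rewrite big_map -sum_steps big_distrr/=; apply: eq_bigr => p _.
  by rewrite mulrA.
have S0 i k j : 0 <= (S i).1.2 k j.
  by have [/(_ k)[h0 hh] _ _] := hS i; rewrite (le_trans h0)// hh.
have L0 k p : p \in L k -> 0 <= p.2.
  move=> /flatten_mapP[i _ /mapP[u + ->]] /=.
  by rewrite mem_cat => /orP[] /mapP[j _ ->] /=; exact: S0.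
pose V w := \sum_(i < m) b i * B (t i) w.
pose U w := \sum_(i < m) c i * Y i w.
pose SL k w := \sum_(p <- L k) p.1 * W p.2 w.
have mSL k : measurable_fun setT (SL k).
  by apply: measurable_sum => p; exact: measurable_funM.
have mV : measurable_fun setT V.
  by apply: measurable_sum => i; exact: measurable_funM.
have mU : measurable_fun setT U.
  by apply: measurable_sum => i; exact: measurable_funM.
pose v k := \int[mu]_(x in D) (\sum_(p <- L k) p.1 * \1_(`]0, p.2]%classic) x) ^+ 2.
have cosSL k u : \int[P]_w cos (SL k w + u) = cos u * expR (- (v k / 2)).
  by rewrite /SL Rintegral_cos_brownian// => p; exact: L0.
have cosV u : \int[P]_w cos (V w + u) = cos u * expR (- (q / 2)).
  exact: Rintegral_cos_gaussian_process.
have indSV k : independent_family P (fun (i : 'I_2) => if i == ord0 then SL k else V).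
  apply: independent_family_pair => A A' mA mA'; apply: indWB.
    (* [process_sigma_algebra_sum] asks for a nonnegative time at every index of type [R * R].
       Clipping at 0 ensures this and changes nothing on members of [L k]. *)
    pose L' := [seq (p.1, Num.max 0 p.2) | p <- L k].
    have -> : SL k = fun w => \sum_(p <- L') p.1 * W p.2 w.
      apply/funext => w; rewrite /SL /L' big_map big_seq [RHS]big_seq.
      by apply: eq_bigr => p pL /=; rewrite max_r// (L0 _ _ pL).
    rewrite /L'; under eq_fun do rewrite big_map.
    by apply: process_sigma_algebra_sum => // p; rewrite /= le_max lexx.
  exact: process_sigma_algebra_sum.
have cosSV k : \int[P]_w cos (SL k w + V w + e) =
    cos e * expR (- ((v k + q) / 2)).
  have := @Rintegral_cos_independent _ _ _ P 2
    (fun i => if i == ord0 then SL k else V) (fun=> 1)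
    (fun i => if i == ord0 then expR (- (v k / 2)) else expR (- (q / 2)))
    _ (indSV k) _ e.
  rewrite big_ord_recl big_ord1 /= -expRD.
  rewrite (_ : - (v k / 2) + - (q / 2) = - ((v k + q) / 2)); last by field.
  move=> <-.
  - by apply: eq_Rintegral => w _; rewrite big_ord_recl big_ord1 /= !mul1r.
  - by move=> i; case: ifP.
  - move=> i u; case: ifP => _.
      by rewrite -cosSL; apply: eq_Rintegral => w _; rewrite mul1r.
    by rewrite -cosV; apply: eq_Rintegral => w _; rewrite mul1r.
have mf i : measurable_fun D (f i) by have [] := wY i.
have mstep i k : measurable_fun D
    (step_function ((S i).1.1 k) ((S i).1.2 k) ((S i).2 k)).
  apply: measurable_sum => j; apply: measurable_funM => //.
have cvU : \int[P]_w cos (SL k w + V w + e) @[k --> \oo] -->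
    \int[P]_w cos (U w + V w + e).
  apply: L2_cvg_Rintegral_cos.
  - by move=> k; apply: measurable_funD => //; exact: measurable_funD.
  - by apply: measurable_funD => //; exact: measurable_funD.
  have := @L2_cvg_sum _ _ _ P setT m c (fun k i w =>
    step_wiener_integral W ((S i).1.1 k) ((S i).1.2 k) ((S i).2 k) w - Y i w)
    measurableT _ _.
  pose G k w := \sum_(i < m) c i *
    (step_wiener_integral W ((S i).1.1 k) ((S i).1.2 k) ((S i).2 k) w - Y i w).
  move=> h; have {}h : (\int[P]_w (G k w ^+ 2)%:E)%E @[k --> \oo] --> 0%E.
    apply: h => [k i|i].
      apply: measurable_funB => //; apply: measurable_sum => j.
      by apply: measurable_funM => //; exact: measurable_funB.
    by have [_ _] := hS i; rewrite expectation.unlock.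
  rewrite [X in X @ _ --> _](_ : _ = fun k => (\int[P]_w (G k w ^+ 2)%:E)%E).
    exact: h.
  apply/funext => k; apply: eq_integral => w _.
  congr ((_ ^+ 2)%:E).
  rewrite (_ : SL k w + V w + e - (U w + V w + e) = SL k w - U w); last by ring.
  rewrite /SL (sumL k (fun u => W u w)) /U -sumrB; apply: eq_bigr => i _.
  by rewrite mulrBr.
have cvv : v k @[k --> \oo] --> \int[mu]_(x in D) (g x ^+ 2).
  have mg : measurable_fun D g.
    by apply: measurable_sum => i; exact: measurable_funM.
  apply: L2_cvg_Rintegral_sqr => //.
  - move=> k; apply: measurable_sum => p; apply: measurable_funM => //.
  - apply: (@le_integrable _ _ R mu _ _ _
      (fun x => \sum_(i < m) ((m%:R * c i ^+ 2)%:E * (f i x ^+ 2)%:E))%E) => //.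
    + by apply/measurable_EFinP; exact: measurable_funX.
    + move=> x _; rewrite /= ger0_norm ?sqr_ge0// sumEFin /= lee_fin.
      rewrite (le_trans _ (ler_norm _))// (le_trans (sqr_sum_le _))//.
      rewrite big_distrr/=; apply: ler_sum => i _.
      by rewrite exprMn mulrA.
    + apply: integrable_sum => // i _; apply: integrableZl => //.
      by have [] := wY i.
  have := @L2_cvg_sum _ _ _ mu D m c (fun k i x =>
    step_function ((S i).1.1 k) ((S i).1.2 k) ((S i).2 k) x - f i x) mD _ _.
  pose G k x := \sum_(i < m) c i *
    (step_function ((S i).1.1 k) ((S i).1.2 k) ((S i).2 k) x - f i x).
  move=> h; have {}h : (\int[mu]_(x in D) (G k x ^+ 2)%:E)%E @[k --> \oo] --> 0%E.
    apply: h => [k i|i]; first exact: measurable_funB.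
    by have [] := hS i.
  rewrite [X in X @ _ --> _](_ : _ = fun k => (\int[mu]_(x in D) (G k x ^+ 2)%:E)%E).
    exact: h.
  apply/funext => k; apply: eq_integral => x _.
  congr ((_ ^+ 2)%:E).
  rewrite (sumL k (fun u => \1_(`]0, u]%classic) x)) /g -sumrB.
  apply: eq_bigr => i _; rewrite mulrBr; congr (_ * _ - _).
  apply: eq_bigr => j _; rewrite indic_itv_oc_sub//.
  by have [/(_ k)[_ hh] _ _] := hS i; exact: hh.
rewrite (eq_Rintegral _ (g := fun w => cos (U w + V w + e))); last first.
  by move=> w _; rewrite big_split.
have cv2 : \int[P]_w cos (SL k w + V w + e) @[k --> \oo] -->
    cos e * expR (- ((\int[mu]_(x in D) (g x ^+ 2) + q) / 2)).
  rewrite (_ : (fun k => _) = fun k => cos e * expR (- ((v k + q) / 2))); last exact/funext.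
  apply: cvgM; first exact: cvg_cst.
  apply: (cvg_comp _ expR); last exact: continuous_expR.
  apply: (@cvgN _ R^o); apply: cvgM; last exact: cvg_cst.
  by apply: (@cvgD _ R^o) => //; exact: cvg_cst.
exact: cvg_unique cvU cv2.
Qed.

End wiener_integrals.

(** * Comparison of the two quadratic forms *)

Unset Implicit Arguments.

Theorem proposition1 (R : realType)
    (d : measure_display) (T : measurableType d) (P : probability T R)
    (d' : measure_display) (T' : measurableType d') (P' : probability T' R)
    (H K : R) (hH : 0 < H < 1) (hK : 0 < K < 1)
    (B : R -> {RV P >-> R}) (hB : bifractional_brownian_motion H K B)
    (W : R -> {RV P >-> R}) (hW : brownian_motion W)
    (hWB : independent_processes W B)
    (X : R -> {RV P >-> R})
    (hX : forall t : R, 0 <= t ->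
      is_wiener_integral W
        (fun theta => (1 - expR (- theta * t)) * theta `^ (- ((1 + K) / 2)))
        (X t))
    (Bf : R -> {RV P' >-> R}) (hBf : fractional_brownian_motion (H * K) Bf) :
  let C1 : R := Num.sqrt (2 `^ (- K) * K / Gamma (1 - K)) in
  let C2 : R := 2 `^ ((1 - K) / 2) in
  same_distribution
    P (fun t w => C1 * X (t `^ (2 * H)) w + B t w)
    P' (fun t w => C2 * Bf t w).
Proof.
move=> C1 C2.
have /andP[H0 _] := hH; have /andP[K0 K1] := hK.
have G0 : 0 < Gamma (1 - K) by rewrite Gamma_gt0 ?subr_gt0// gerBl ltW.
have C1E : C1 * C1 = 2 `^ (- K) * K / Gamma (1 - K).
  rewrite -expr2 sqr_sqrtr// divr_ge0 ?(ltW G0)// mulr_ge0 ?powR_ge0//.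
  exact: ltW.
(* The 2 compensates the factor 1/2 of [fractional_cov], leaving the [2 ^ (- K)] of the bifractional
   covariance. *)
have C2E : C2 * C2 = 2 * 2 `^ (- K).
  rewrite /C2 -powRD ?pnatr_eq0 ?implybT//.
  rewrite (_ : (1 - K) / 2 + (1 - K) / 2 = 1 + - K); last by field.
  by rewrite powRD ?pnatr_eq0 ?implybT// powRr1.
apply: same_distribution_cos.
- by move=> t _; apply: measurable_funD => //; exact: measurable_funM.
- by move=> t _; exact: measurable_funM.
move=> n t a e t0.
pose k t x : R := (1 - expR (- x * t)) * x `^ (- ((1 + K) / 2)).
pose tau i := t i `^ (2 * H).
have tau0 i : 0 <= tau i by exact: powR_ge0.
(* The constants are absorbed into the coefficients, since the cosine formulas are for arbitrary
   linear combinations. *)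
transitivity (\int[P]_w cos (\sum_(i < n)
    ((a i * C1) * X (tau i) w + a i * B (t i) w) + e)).
  apply: eq_Rintegral => w _; congr (cos (_ + e)); apply: eq_bigr => i _.
  by rewrite mulrDr mulrA.
rewrite (@Rintegral_cos_wiener _ _ _ _ W B _ hW hB hWB n (fun i => k (tau i))
  (fun i => X (tau i)) (fun i => a i * C1) a t)//; last first.
  by move=> i; exact: hX.
transitivity (\int[P']_w cos (\sum_(i < n) (a i * C2) * Bf (t i) w + e)); last first.
  by apply: eq_Rintegral => w _; congr (cos (_ + e)); apply: eq_bigr => i _; rewrite mulrA.
rewrite (@Rintegral_cos_gaussian_process _ _ _ _ Bf _ n t (fun i => a i * C2) e hBf)//.
congr (_ * expR (- (_ / 2))).
have iff i j : lebesgue_measure.-integrable `[0, +oo[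
    (EFin \o (fun x => k (tau i) x * k (tau j) x)).
  by have [] := Rintegral_kernel_product K0 K1 (tau0 i) (tau0 j).
have sqrE := @Rintegral_sqr_sum _ (measurableTypeR R) R lebesgue_measure _ n
  (fun i => a i * C1) _ (measurable_itv `[0, +oo[) iff.
rewrite /= in sqrE; rewrite sqrE.
rewrite -big_split/=; apply: eq_bigr => i _.
rewrite -big_split/=; apply: eq_bigr => j _.
have [_ kE] := Rintegral_kernel_product K0 K1 (tau0 i) (tau0 j).
rewrite kE /bifractional_cov /fractional_cov /tau -!powRrM.
rewrite [2 * (H * K)]mulrA.
(* In these letters [C1^2] cancels [Gamma (1 - K) / K], and the claim is
   [(x + y - z) + (z - u) = x + y - u], up to the factor [2 ^ (- K)] and the coefficients. *)
set x := t i `^ _; set y := t j `^ _; set z := (_ + _) `^ K; set u := `|_| `^ _.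
rewrite [a i * C1 * _]mulrACA [a i * C2 * _]mulrACA C1E C2E; field.
by rewrite !gt_eqF.
Qed.
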